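(* There is an absolute constant $C>0$ such that the following holds. Let $P$ be a simple $d$-dimensional polytope with $n$ facets, where $n-d=2$, and let the edges of $P$ be endowed with a unique sink orientation. Then the directed random walk on $P$, started at an arbitrary vertex, arrives at the (unique global) sink after an expected number of at most $C\log^2 n$ steps.
   Context: A sink of a directed graph is a vertex with no outgoing edges. An orientation of the edges of a polytope $P$ is a unique sink orientation if for every non-empty face $F$ of $P$, the directed graph formed by the vertices and edges of $F$ has exactly one sink. The directed random walk on a directed graph started at a vertex $v_0$ is the process which, at each step, if the current vertex $v_k$ has outgoing edges, chooses one of the outgoing edges at $v_k$ uniformly at random (independently of the past) and moves to its other endpoint $v_{k+1}$; the walk stops when it reaches a sink. The number of steps is the number of moves made until a sink is reached. *)

(* Defs.v *)
From HB Require Import structures.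
From mathcomp Require Import all_boot all_order all_algebra finmap.
From mathcomp Require Import all_classical all_reals all_analysis.

Set Implicit Arguments.
Unset Strict Implicit.
Unset Printing Implicit Defensive.

Import Order.TTheory GRing.Theory Num.Theory.
Import numFieldNormedType.Exports.

Local Open Scope classical_set_scope.
Local Open Scope card_scope.
Local Open Scope ring_scope.

Section Polytopes.
Context {R : realType} {m : nat}.
Implicit Types (P F e S : set 'rV[R]_m) (u v w : 'rV[R]_m).

Definition inner u v : R := \sum_(i < m) u 0 i * v 0 i.

(* A polytope is a bounded intersection of finitely many half-spaces; it need
   not be full-dimensional in the ambient space. *)
Definition polytope P : Prop :=
  bounded_set P /\
  exists s : seq ('rV[R]_m * R),
    P = [set x | forall h, h \in s -> inner h.1 x <= h.2].

Definition affine_hull S : set 'rV[R]_m :=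
  [set x | exists k (p : 'I_k -> 'rV[R]_m) (a : 'I_k -> R),
     [/\ forall i, S (p i), \sum_(i < k) a i = 1
       & x = \sum_(i < k) a i *: p i]].

(* Only nonempty sets have a dimension in this sense. *)
Definition has_dim S (k : nat) : Prop :=
  exists (x0 : 'rV[R]_m) (U : {vspace 'rV[R]_m}),
    affine_hull S = [set x0 + u | u in [set` U]] /\ \dim U = k.

(* Taking c = 0, both P (b = 0) and the empty set (b = 1) are faces of P. *)
Definition face P F : Prop :=
  exists (c : 'rV[R]_m) (b : R),
    (forall x, P x -> inner c x <= b) /\ F = P `&` [set x | inner c x = b].

Definition vertex P v : Prop := face P [set v].

Definition edge P e : Prop := face P e /\ has_dim e 1.

Definition facet P F : Prop :=
  face P F /\ exists k : nat, has_dim F k /\ has_dim P k.+1.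

Definition simple_polytope P (d : nat) : Prop :=
  [/\ polytope P, has_dim P d &
      forall v, vertex P v -> [set F | facet P F /\ F v] #= `I_d].

Definition adjacent P u v : Prop :=
  [/\ u <> v, vertex P u, vertex P v & exists2 e, edge P e & e u /\ e v].

(* [arc u v] means that the edge joining u and v is directed from u to v. *)
Definition edge_orientation P (arc : 'rV[R]_m -> 'rV[R]_m -> Prop) : Prop :=
  (forall u v, arc u v -> adjacent P u v) /\
  (forall u v, adjacent P u v ->
     (arc u v /\ ~ arc v u) \/ (arc v u /\ ~ arc u v)).

End Polytopes.

Definition sink (T : Type) (V : set T) (arc : T -> T -> Prop) (v : T) : Prop :=
  V v /\ forall w, ~ arc v w.

Definition unique_sink_orientation (R : realType) (m : nat)
    (P : set 'rV[R]_m) (arc : 'rV[R]_m -> 'rV[R]_m -> Prop) : Prop :=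
  edge_orientation P arc /\
  forall F, face P F -> F !=set0 ->
    exists! v, sink (vertex F) (fun u w => arc u w /\ adjacent F u w) v.

Section RandomWalk.
Context {R : realType} {V : choiceType}.
Variables (vert : set V) (arc : V -> V -> Prop).

(* Sinks are absorbing: a stopped walk is kept at its final vertex. *)
Definition transition (v w : V) : R :=
  if `[< sink vert arc v >] then (w == v)%:R
  else if `[< arc v w >] then (#|` fset_set [set z | arc v z]|%:R)^-1
  else 0.

Context {disp : measure_display} {Omega : measurableType disp}.

(* X k is the position after k moves; the last clause gives the conditional
   law of X k.+1 given the whole history X 0, ..., X k, in product form. *)
Definition directed_random_walk (Pr : probability Omega R) (v0 : V)
    (X : nat -> Omega -> V) : Prop :=
  [/\ forall k v, measurable [set t | X k t = v],
      Pr [set t | X 0%N t = v0] = 1%E &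
      forall (k : nat) (p : nat -> V),
        Pr [set t | forall i, (i <= k.+1)%N -> X i t = p i] =
        (Pr [set t | forall i, (i <= k)%N -> X i t = p i] *
         (transition (p k) (p k.+1))%:E)%E].

(* The infimum is +oo if the walk never reaches a sink. *)
Definition number_of_steps (X : nat -> Omega -> V) (t : Omega) : \bar R :=
  ereal_inf [set (k%:R)%:E | k in [set k : nat | sink vert arc (X k t)]].

End RandomWalk.

(* Main.v *)
Require Import Defs.
From HB Require Import structures.
From mathcomp Require Import all_boot all_order all_algebra finmap.
From mathcomp Require Import all_classical all_reals all_analysis.
From mathcomp Require Import zify ring lra.
Set Implicit Arguments.
Unset Strict Implicit.
Unset Printing Implicit Defensive.
Import Order.TTheory GRing.Theory Num.Theory.
Import numFieldNormedType.Exports.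

(* A simple d-polytope with d + 2 facets is combinatorially a grid. Every vertex
   misses exactly two facets, and an edge leaving the vertex that misses {f, g}
   along which a facet h is given up ends in the vertex missing {f, h} or the one
   missing {g, h}, never both. A graph with this exchange property is complete
   bipartite, so vertices are the cells of a grid A * B, edges join cells of a
   common row or column, and subgrids are faces.

   Of the unique sink orientation only the triangles and quadrilaterals matter:
   rows and columns become strict linear orders, and no 2 * 2 subgrid has two
   sinks or is a directed cycle. This already forces acyclicity. Let E_t be the
   set of cells that cannot reach a cell with at least t out-neighbours both in
   its row and in its column. E_t is closed under arcs and, if it is not
   everything, contains a t * t box: the one spanned by the out-neighbours of a
   last cell outside E_t. From a cell x outside a closed set containing a box, all
   rows of the box lie below x in its column or all columns of the box lie below x
   in its row. Inside E_(2t) one of the two out-degrees is below 2t; as a uniform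
   downward jump halves a rank on average, within O(log n) expected steps the walk
   drops to ranks of order t, where it hits a row or a column of the box with
   probability bounded below, and from there the box itself. So each of the
   O(log n) passages from E_(2t) to E_t takes O(log n) expected steps. *)

(** * Acyclicity of grid orientations *)

(** The whole time estimate is one deterministic function on the cells that, away from the sink,
    exceeds its average over the out-neighbours by at least 1; the random walk enters only at the
    end, through its law on finite histories. The function is a sum with one summand per phase. Each
    summand is at least its average everywhere and exceeds it by 1 where its phase is active, so the
    phases add up without following the order in which the walk passes through them. Thresholds
    double because the box then has at least half as many lines as there are ranks below 2t, and the
    gain at the box pays for the loss at those ranks. Acyclicity has to come from squares although a
    directed cycle may be long; the argument looks at the cells that a shortest closed walk spans
    but does not visit. The geometry starts from an arbitrary list of inequalities, whereas
    simplicity counts facets as sets. An irredundant list identifies the two, and a vertex is then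
    known by its two inequalities that are not tight. *)

Definition strict_total (T : eqType) (r : rel T) : Prop :=
  [/\ irreflexive r, transitive r & forall x y, x != y -> r x y || r y x].

Definition grid_orientation (A B : finType) (H : A -> rel B) (V : B -> rel A)
  : Prop :=
  [/\ forall r, strict_total (H r), forall c, strict_total (V c),
      forall r r' c c', ~~ [&& H r c' c, V c r' r, H r' c c' & V c' r r'] &
      forall r r' c c', ~~ [&& H r c c', V c' r r', H r' c' c & V c r' r]].

Definition grid_arc (A B : finType) (H : A -> rel B) (V : B -> rel A)
    (x y : A * B) : bool :=
  (x.1 == y.1) && H x.1 x.2 y.2 || (x.2 == y.2) && V x.2 x.1 y.1.

Section Acyclic.
Context {A B : finType} {H : A -> rel B} {V : B -> rel A}.
Hypothesis oHV : grid_orientation H V.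

Local Definition wkH r c c' := (c == c') || H r c c'.
Local Definition wkV c r r' := (r == r') || V c r r'.
(** Arcs are grouped into a horizontal move followed by a vertical one, either possibly trivial. On
    a shortest closed walk both turn out to be nontrivial ([stepH]), so that the walk alternates
    strictly. *)
Local Definition two_step (x y : A * B) :=
  [&& x != y, wkH x.1 x.2 y.2 & wkV y.2 x.1 y.1].

Local Lemma Hirr r c : H r c c = false.
Proof. by case: oHV => /(_ r) []. Qed.
Local Lemma Virr c r : V c r r = false.
Proof. by case: oHV => _ /(_ c) []. Qed.
Local Lemma Htr r : transitive (H r).
Proof. by case: oHV => /(_ r) []. Qed.
Local Lemma Vtr c : transitive (V c).
Proof. by case: oHV => _ /(_ c) []. Qed.
Local Lemma Htot r c c' : c != c' -> H r c c' || H r c' c.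
Proof. by case: oHV => /(_ r) [_ _ h] _ _ _; apply: h. Qed.
Local Lemma Vtot c r r' : r != r' -> V c r r' || V c r' r.
Proof. by case: oHV => _ /(_ c) [_ _ h] _ _; apply: h. Qed.

Local Lemma wkHN r c c' : ~~ wkH r c c' -> H r c' c.
Proof. by rewrite negb_or => /andP[ne nH]; have := Htot r ne; rewrite (negbTE nH). Qed.
Local Lemma wkVN c r r' : ~~ wkV c r r' -> V c r' r.
Proof. by rewrite negb_or => /andP[ne nH]; have := Vtot c ne; rewrite (negbTE nH). Qed.
Local Lemma Hne r c c' : H r c c' -> c != c'.
Proof. by move=> h; apply/eqP => e; rewrite e Hirr in h. Qed.
Local Lemma Vne c r r' : V c r r' -> r != r'.
Proof. by move=> h; apply/eqP => e; rewrite e Virr in h. Qed.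
Local Lemma HwkH r c1 c2 c3 : H r c1 c2 -> wkH r c2 c3 -> H r c1 c3.
Proof. by move=> h /orP[/eqP<-//|]; apply: Htr. Qed.
Local Lemma wkVV r c1 c2 c3 : wkV r c1 c2 -> V r c2 c3 -> V r c1 c3.
Proof. by move=> /orP[/eqP->//|]; apply: Vtr. Qed.

Local Definition closed_walk (n : nat) (g : nat -> A * B) :=
  [/\ 0 < n, forall t, t < n -> two_step (g t) (g t.+1) & g n = g 0].

(* Cell (t, s) lies in the row of [f t] and the column of [f s]. Since a shortest
   closed walk has no shortcut, each cell off the walk is either below or above
   all cells of the walk in its row and in its column ([lowP], [highP]). *)
Section Shortest.
Context {m : nat} {f : nat -> A * B}.
Hypothesis mP : 0 < m.
Hypothesis fW : forall t, two_step (f t) (f t.+1).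
Hypothesis fm : forall t, f (t + m) = f t.
Hypothesis shortest : forall n g, n < m -> ~ closed_walk n g.
Local Notation rho t := (f t).1.
Local Notation gam t := (f t).2.

Local Lemma pair_ne (x y : A * B) : x.1 != y.1 \/ x.2 != y.2 -> x != y.
Proof. by case=> h; apply/eqP => e; rewrite e eqxx in h. Qed.

Local Lemma distinct t s : t < s -> s < t + m -> f t != f s.
Proof.
move=> ts st; apply/eqP => e.
apply: (@shortest (s - t) (fun u => f (t + u))); first by lia.
split; first by lia.
- by move=> u _; rewrite addnS; apply: fW.
- by rewrite addn0 e; congr f; lia.
Qed.

Local Lemma chord t s : t.+1 < s -> s <= t + m -> ~~ two_step (f t) (f s).
Proof.
move=> ts st; apply/negP => W.
apply: (@shortest (1 + (t + m - s)) (fun u => if u is v.+1 then f (s + v) else f t)).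
  by lia.
split=> //.
- case=> [|u] _; first by rewrite addn0.
  by rewrite addnS; apply: fW.
- by rewrite add1n subnKC// fm.
Qed.

(** Through [z], the segment from [f t.+1] to [f s.-1] closes up to a walk of length [s - t], which
    is less than [m]. *)
Local Lemma bypass t s z : t.+1 < s -> s < t + m ->
  ~ (two_step (f s.-1) z /\ two_step z (f t.+1)).
Proof.
move=> ts st [W1 W2].
pose w := (s.-1 - t.+1)%N.
apply: (@shortest w.+2 (fun u => if u <= w then f (t.+1 + u)
                                 else if u == w.+1 then z else f t.+1)).
  by rewrite /w; lia.
have E1 : (w < w) = false by lia.
have E2 : (w.+1 < w) = false by lia.
have E3 : (w.+2 == w.+1) = false by lia.
split=> //; last by rewrite E2 E3 leq0n addn0.
move=> u uw; case: (ltngtP u w) => [uw'|uw'|->].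
- by rewrite addnS; apply: fW.
- have -> : u = w.+1 by lia.
  by rewrite E3 eqxx.
- by rewrite eqxx; suff -> : t.+1 + w = s.-1 by []; rewrite /w; lia.
Qed.

Local Lemma m_gt1 : 1 < m.
Proof.
rewrite ltn_neqAle mP andbT; apply/eqP => m1.
by have := fW 0; rewrite -[1]add0n m1 fm /two_step eqxx.
Qed.

(** A step without vertical part merges with the next step, and one without horizontal part merges
    with the previous step; either way a chord arises. *)
Local Lemma stepH t : gam t != gam t.+1 /\ rho t != rho t.+1.
Proof.
have m1 := m_gt1.
have key u : rho u != rho u.+1.
  apply/eqP => e.
  have /and3P[ne h _] := fW u; have /and3P[_ h' v'] := fW u.+1.
  have hs : H (rho u) (gam u) (gam u.+1).
    case/orP: h => // /eqP e'; move: ne.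
    by rewrite [f u]surjective_pairing [f u.+1]surjective_pairing e e' eqxx.
  rewrite -e in h' v'.
  have hs2 := HwkH hs h'.
  have := @chord u u.+2 (ltnSn _); rewrite -addn2 leq_add2l => /(_ m1)/negP; apply.
  rewrite /two_step addn2; apply/and3P; split.
  - by apply: pair_ne; right; apply: Hne hs2.
  - by rewrite /wkH hs2 orbT.
  - by [].
split; last exact: key.
apply/eqP => e.
(* Since [t] may be 0, the previous step is taken one period later. *)
have [u ut] : exists u, u.+1 = t + m by exists (t + m).-1; lia.
have /and3P[_ h v] := fW u; have /and3P[ne h' v'] := fW u.+1.
have e' : gam u.+1 = gam u.+2 by rewrite ut fm -addSn fm.
have vs : V (gam u.+1) (rho u.+1) (rho u.+2).
  by case/orP: v' => [/eqP e2|]; [have := key u.+1; rewrite e2 eqxx|rewrite e'].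
have vs2 := wkVV v vs.
have := @chord u u.+2 (ltnSn _); rewrite -addn2 leq_add2l => /(_ m1)/negP; apply.
rewrite /two_step addn2; apply/and3P; split.
- by apply: pair_ne; left; apply: Vne vs2.
- by rewrite -e'.
- by rewrite -e' /wkV vs2 orbT.
Qed.

Local Lemma stepHs t : H (rho t) (gam t) (gam t.+1).
Proof. by have /and3P[_ /orP[/eqP e|//] _] := fW t; have [] := stepH t;
  rewrite e eqxx. Qed.
Local Lemma stepVs t : V (gam t.+1) (rho t) (rho t.+1).
Proof. by have /and3P[_ _ /orP[/eqP e|//]] := fW t; have [_] := stepH t;
  rewrite e eqxx. Qed.

Local Lemma m_gt2 : 2 < m.
Proof.
rewrite ltn_neqAle m_gt1 andbT; apply/eqP => m2.
case: oHV => _ _ _ /(_ (rho 0) (rho 1) (gam 0) (gam 1))/negP; apply.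
have e2 : f 2 = f 0 by rewrite -[2]add0n m2 fm.
rewrite (stepHs 0) (stepVs 0) /=.
by have := stepHs 1; have := stepVs 1; rewrite e2 => -> ->.
Qed.

Local Lemma gam_ne t s : t < s -> s < t + m -> gam s != gam t.
Proof.
move=> ts st; apply/eqP => e.
have [ets|ts'] := eqVneq s t.+1.
  by have [] := stepH t; rewrite -ets e eqxx.
have {}ts' : t.+1 < s by lia.
have ne := distinct ts st.
have nc := chord ts' (ltnW st).
have v : V (gam s) (rho s) (rho t).
  apply: wkVN; apply: contra nc => v; apply/and3P; split=> //.
  by rewrite /wkH e eqxx.
have [u us] : exists u, u.+1 = s by exists s.-1; lia.
have /negP : ~~ two_step (f u) (f (t + m)) by apply: chord; lia.
apply.
rewrite fm; have /and3P[_ h' v'] := fW u; rewrite us in h' v'.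
have vs := wkVV v' v.
apply/and3P; split; first by apply: pair_ne; left; apply: Vne vs.
- by rewrite -e.
- by rewrite /wkV -e vs orbT.
Qed.

(** The indices left out, [s = t] and [s = t.+1] modulo [m], give the two cells where step [t]
    starts and turns. *)
Local Definition off t s := (t.+1 < s) && (s < t + m).

Local Definition low t s := H (rho t) (gam t) (gam s).

Local Lemma lowP t s : off t s -> low t s ->
  [/\ H (rho t) (gam t.+1) (gam s), V (gam s) (rho s) (rho t)
    & V (gam s) (rho s.-1) (rho t)].
Proof.
move=> /andP[ts st] l; have lH : H (rho t) (gam t) (gam s) := l.
have v : V (gam s) (rho s) (rho t).
  apply: wkVN; apply/negP => v; have /negP := chord ts (ltnW st); apply.
  by apply/and3P; split=> //; [apply: pair_ne; right;
    apply: Hne lH|rewrite /wkH lH orbT].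
have v1 : V (gam s) (rho s.-1) (rho t).
  by have := stepVs s.-1; rewrite prednK 1?(leq_trans _ ts)// => v1; apply: Vtr v.
split=> //; apply: wkHN; apply/negP => h.
apply: (@bypass _ _ (rho t, gam s) ts st); split; apply/and3P; split.
- by apply: pair_ne; left; apply: Vne v1.
- by have /and3P[_ + _] := fW s.-1; rewrite prednK 1?(leq_trans _ ts).
- by rewrite /wkV v1 orbT.
- apply: pair_ne; right => /=; apply: gam_ne => //; lia.
- by [].
- by have /and3P[] := fW t.
Qed.

Local Lemma highP t s : off t s -> ~~ low t s ->
  [/\ H (rho t) (gam s) (gam t), H (rho t) (gam s) (gam t.+1),
      V (gam s) (rho t) (rho s) & V (gam s) (rho t) (rho s.-1)].
Proof.
move=> /andP[ts st] l.
have ts1 : t < s by lia.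
have h : H (rho t) (gam s) (gam t).
  by have := Htot (rho t) (gam_ne ts1 st); rewrite -/(low t s) (negbTE l) orbF.
have h1 : H (rho t) (gam s) (gam t.+1) by apply: Htr h (stepHs t).
have v : V (gam s) (rho t) (rho s.-1).
  apply: wkVN; apply/negP => v.
  apply: (@bypass _ _ (rho t, gam s) ts st); split; apply/and3P; split.
  - apply: pair_ne; right => /=; rewrite eq_sym; have [+ _] := stepH s.-1.
    by rewrite prednK 1?eq_sym// (leq_trans _ ts).
  - by have /and3P[_ + _] := fW s.-1; rewrite prednK 1?(leq_trans _ ts).
  - by [].
  - by apply: pair_ne; right; apply: Hne h1.
  - by rewrite /wkH h1 orbT.
  - by have /and3P[] := fW t.
split=> //; apply: Vtr v _.
by have := stepVs s.-1; rewrite prednK 1?(leq_trans _ ts).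
Qed.

(** The cell in the row of [f t] and the column of [f s] is on the walk: it is the start or the turn
    of step [t]. Values of [f] are compared because indices matter only modulo [m]. *)
Local Definition corner s t := f s = f t \/ f s.-1 = f t /\ f s = f t.+1.

(* The corners (t, s') and (t', s) of the square lie on the cycle, so equal
   types at (t, s) and (t', s') would give the square two sinks. *)
Local Lemma opposite t s t' s' : off t s -> off t' s' -> corner s t' ->
  corner s' t -> low t s = ~~ low t' s'.
Proof.
move=> o o' c c'; case: oHV => _ _ ns _.
have [l|l] := boolP (low t s); have [l'|l'] := boolP (low t' s') => //; exfalso.
- have [h1 v1 v2] := lowP o l; have [h1' v1' v2'] := lowP o' l'.
  have := ns (rho t) (rho t') (gam s) (gam s'); apply/negP/negPn.
  rewrite /low in l l'.
  apply/and4P; split.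
  + by case: c' => [->|[_ ->]].
  + by case: c => [<-|[<- _]].
  + by case: c => [->|[_ ->]].
  + by case: c' => [<-|[<- _]].
- have [h1 h2 v1 v2] := highP o l; have [h1' h2' v1' v2'] := highP o' l'.
  have := ns (rho t) (rho t') (gam s') (gam s); apply/negP/negPn.
  apply/and4P; split.
  + by case: c' => [->|[_ ->]].
  + by case: c' => [<-|[<- _]].
  + by case: c => [->|[_ ->]].
  + by case: c => [<-|[<- _]].
Qed.

(** Two uses of [opposite] lead from one cell to the next in a row, so the type is constant along
    row [a]. Going from one end of that row to the other around the walk near [a] takes three uses,
    an odd number of negations. *)
Local Lemma no_shortest : False.
Proof.
have m2 := m_gt2.
have fmS u : f (u + m).+1 = f u.+1 by rewrite -addSn fm.
(* The period [m] stands for index 0, so that [a.-1] is the preceding index. *)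
pose a := m.
have row y : a.+1 < y -> y.+1 < a + m -> low a y = low a y.+1.
  move=> ay ya.
  rewrite (@opposite a y y (a.+1 + m)); first last.
  - by right; rewrite addSn /= fm fmS.
  - by left.
  - by rewrite /off; lia.
  - by rewrite /off; lia.
  rewrite (@opposite y (a.+1 + m) a y.+1) ?negbK//.
  - by rewrite /off; lia.
  - by rewrite /off; lia.
  - by right; rewrite addSn /= fm fmS.
  - by right.
have const k : a.+2 + k < a + m -> low a a.+2 = low a (a.+2 + k).
  elim: k => [|k IH] lk; first by rewrite addn0.
  by rewrite IH ?addnS; [apply: row; lia|lia].
have e1 : low a.-1 a.+1 = ~~ low a (a.-1 + m).
  apply: opposite; rewrite /off; try lia.
  - by right; split=> //; rewrite prednK// /a; lia.
  - by left; rewrite fm.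
have e2 : low a.-1 a.+1 = ~~ low a.+1 (a + m).
  apply: opposite; rewrite /off /a; try lia.
  - by left.
  - right; rewrite fm prednK//; split=> //.
    by rewrite -[in RHS](fm m.-1); congr f; lia.
have e3 : low a.+1 (a + m) = ~~ low a a.+2.
  apply: opposite; rewrite /off /a; try lia.
  - by left; rewrite fm.
  - by right.
have := const (m - 3)%N; rewrite (_ : a.+2 + _ = a.-1 + m); last by rewrite /a; lia.
move=> /(_ _); rewrite /a in e1 e2 e3 *.
have lt : m.-1 + m < m + m by lia.
move=> /(_ lt) e4; move: e1; rewrite -e4 e2 e3.
by case: (low _ _).
Qed.
End Shortest.

Local Lemma no_closed_walk n g : ~ closed_walk n g.
Proof.
elim/ltn_ind: n g => n IH g [n0 gW gn].
pose f t := g (t %% n).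
apply: (@no_shortest n f n0).
- move=> t; rewrite /f.
  have tn : t %% n < n by rewrite ltn_mod.
  have := gW _ tn; have [e|e] := eqVneq (t %% n).+1 n.
    rewrite e gn; suff -> : t.+1 %% n = 0 by [].
    by rewrite -addn1 -modnDml addn1 e modnn.
  by rewrite -[in X in _ -> X]addn1 -modnDml addn1 [_.+1 %% n]modn_small// ltn_neqAle e.
- by move=> t; rewrite /f modnDr.
- by move=> k h kn; apply: IH kn h.
Qed.

Lemma grid_acyclic x y :
  connect (grid_arc H V) x y -> connect (grid_arc H V) y x -> x = y.
Proof.
have sub u v : grid_arc H V u v -> two_step u v.
  case: u v => [u1 u2] [v1 v2] /orP[]/andP[/= /eqP<- h]; apply/and3P; split=> /=.
  - by apply: pair_ne; right; apply: Hne h.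
  - by rewrite /wkH h orbT.
  - by rewrite /wkV eqxx.
  - by apply: pair_ne; left; apply: Vne h.
  - by rewrite /wkH eqxx.
  - by rewrite /wkV h orbT.
move=> /connectP[p pp ->] /connectP[q pq e].
apply/eqP/negPn/negP => ne.
have pth : path two_step x (p ++ q).
  by rewrite cat_path; apply/andP; split; [apply: sub_path pp|apply: sub_path pq].
apply: (@no_closed_walk (size (p ++ q)) (nth x (x :: p ++ q))); split.
- by case: p q {pp pq pth} ne e => [|? ?] //=; rewrite eqxx.
- by move=> t; apply/pathP.
- by rewrite -last_nth last_cat -e.
Qed.

End Acyclic.

Local Open Scope ring_scope.

(** * Uniform downward jumps *)

Definition rank (T : finType) (r : rel T) (x : T) : nat := #|[set y | r x y]|.

Section Rank.
Context {T : finType} {r : rel T}.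
Hypothesis r_total : strict_total r.

Lemma rank_lt x y : r x y -> (rank r y < rank r x)%N.
Proof.
case: r_total => irr tr _ xy; apply: proper_card; apply/properP; split.
  by apply/fintype.subsetP => z; rewrite !inE; apply: tr.
by exists y; rewrite !inE ?irr.
Qed.

Lemma rank_inj : injective (rank r).
Proof.
move=> x y e; apply/eqP/negPn/negP => ne; case: r_total => _ _ /(_ _ _ ne).
by move=> /orP[] /rank_lt; rewrite e ltnn.
Qed.

(** Ranks are injective and decrease along [r], so the out-neighbours of [x] take each rank below
    that of [x] exactly once. *)
Lemma sum_rank (R : nmodType) (g : nat -> R) x :
  \sum_(y in [set y | r x y]) g (rank r y) = \sum_(t < rank r x) g t.
Proof.
rewrite -(big_mkord xpredT g) /index_iota subn0 -big_enum /=.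
rewrite -(big_map (rank r) xpredT g); apply: perm_big; apply: uniq_perm.
- by rewrite map_inj_uniq ?enum_uniq//; apply: rank_inj.
- exact: iota_uniq.
have sub : {subset map (rank r) (enum [set y | r x y]) <= iota 0 (rank r x)}.
  move=> t /mapP[y]; rewrite mem_enum inE => xy ->.
  by rewrite mem_iota; apply: rank_lt.
apply: (uniq_min_size _ sub _).2; last by rewrite size_iota size_map -cardE.
by rewrite map_inj_uniq ?enum_uniq//; apply: rank_inj.
Qed.

End Rank.

Section Harmonic.
Context {R : realFieldType}.

(* [run k j] solves [run k j = 1 + (\sum_(t < j) run k t) / j] for [k <= j]: it
   is the expected number of uniform downward jumps from [j] needed to get
   below [k]. *)
Definition run (k j : nat) : R :=
  if (j < k)%N then 0 else 1 + \sum_(k.+1 <= t < j.+1) t%:R^-1.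

Lemma run_small k j : (j < k)%N -> run k j = 0.
Proof. by rewrite /run => ->. Qed.

Lemma run_ge0 k j : 0 <= run k j.
Proof.
rewrite /run; case: ifP => // _; apply: addr_ge0 => //.
by apply: sumr_ge0 => t _; rewrite invr_ge0.
Qed.

Lemma sum_run k j : (k <= j)%N ->
  \sum_(t < j) run k t = j%:R * (run k j - 1).
Proof.
elim: j => [|j IH]; first by rewrite big_ord0 mul0r.
rewrite leq_eqVlt => /orP[/eqP<-|kj].
  rewrite {2}/run ltnn big_geq// addr0 subrr mulr0.
  by apply: big1 => i _; rewrite run_small.
rewrite big_ord_recr /= IH//.
have -> : run k j.+1 = run k j + j.+1%:R^-1.
  have e1 : (j.+1 < k)%N = false by lia.
  have e2 : (j < k)%N = false by lia.
  by rewrite /run e1 e2 big_nat_recr//= addrA.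
have : j.+1%:R != 0 :> R by rewrite pnatr_eq0.
rewrite -natr1 => nz; field.
by rewrite natr1 in nz *.
Qed.
End Harmonic.

Section Bounds.
Context {R : realFieldType} {T : finType}.

Lemma pick_bound (O S : {set T}) (val : T -> R) (s : nat) (M p : R) :
  S \subset O -> (s <= #|S|)%N -> p <= M ->
  (forall y, y \in O -> val y <= M) -> (forall y, y \in S -> val y <= p) ->
  \sum_(y in O) val y <= #|O|%:R * M - s%:R * (M - p).
Proof.
move=> SO sS pM vO vS.
apply: (@le_trans _ _ (\sum_(y in O) (M - (y \in S)%:R * (M - p)))).
  apply: ler_sum => y yO; case: (boolP (y \in S)) => yS.
    by rewrite mul1r opprB addrCA subrr addr0 vS.
  by rewrite mul0r subr0 vO.
rewrite sumrB sumr_const mulr_natl lerD2l lerN2 -mulr_suml ler_wpM2r ?subr_ge0//.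
rewrite -natr_sum ler_nat; apply: (leq_trans sS).
rewrite -sum1_card [X in (_ <= X)%N]big_mkcond [X in (X <= _)%N]big_mkcond /=.
apply: leq_sum => y _; case: (boolP (y \in S)) => // yS.
by rewrite (fintype.subsetP SO).
Qed.

(** Against the exact solution [w + lam * run k], only the [k] ranks below [k] can lose, each at
    most [M - w], while at least [s] members of [S] gain [w - p] each. The unit that [run] loses per
    jump leaves [- lam * rank r x] to pay for the elapsed step. *)
Lemma run_bound (r : rel T) (x : T) (S : {set T}) (val : T -> R) (k s : nat)
    (w M p lam : R) : strict_total r -> (k <= rank r x)%N ->
  S \subset [set y | r x y] -> (s <= #|S|)%N -> 0 <= lam -> w <= M -> p <= w ->
  (forall y, y \in S -> val y <= p) ->
  (forall y, r x y -> (rank r y < k)%N -> val y <= M) ->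
  (forall y, r x y -> y \notin S -> (k <= rank r y)%N ->
     val y <= w + lam * run k (rank r y)) ->
  \sum_(y in [set y | r x y]) val y <=
    (rank r x)%:R * w
    + lam * ((rank r x)%:R * (run k (rank r x) - 1))
    + k%:R * (M - w) - s%:R * (w - p).
Proof.
move=> rT kx SO sS l0 wM pw vS vM vw.
set j := rank r x in kx *.
pose g t : R := lam * run k t + (t < k)%N%:R * (M - w).
have gE t : g t = lam * run k t + (t < k)%N%:R * (M - w) by [].
apply: (@le_trans _ _
  (\sum_(y in [set y | r x y]) ((val y - g (rank r y)) + g (rank r y)))).
  by apply: ler_sum => y _; rewrite subrK.
rewrite big_split /= (sum_rank rT g) -/j.
have -> : \sum_(t < j) g t = lam * (j%:R * (run k j - 1)) + k%:R * (M - w).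
  rewrite /g big_split /= -mulr_sumr sum_run// -mulr_suml; congr (_ + _ * _).
  rewrite -natr_sum; congr _%:R.
  rewrite -(big_mkord xpredT (fun t => (t < k)%N : nat)) (big_cat_nat (leq0n k) kx)//=.
  rewrite [X in (_ + X)%N]big_nat_cond [X in (_ + X)%N]big1 ?addn0.
    rewrite big_nat_cond (eq_bigr (fun=> 1%N)); last by move=> t /andP[/andP[_ ->]].
    by rewrite -big_nat_cond sum_nat_const_nat muln1 subn0.
  by move=> t /andP[/andP[kt _] _]; rewrite ltnNge kt.
have : \sum_(y in [set y | r x y]) (val y - g (rank r y))
       <= #|[set y | r x y]|%:R * w - s%:R * (w - p).
  apply: (pick_bound SO) => //.
  - move=> y; rewrite inE => xy; rewrite lerBlDr gE.
    have := run_ge0 (R := R) k (rank r y).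
    case: (boolP (y \in S)) => yS.
      move=> /(mulr_ge0 l0); have := vS _ yS.
      have : 0 <= (rank r y < k)%:R * (M - w) by rewrite mulr_ge0// subr_ge0.
      by lra.
    case: (ltnP (rank r y) k) => yk.
      by rewrite mul1r run_small// mulr0 add0r => _; have := vM y xy yk; lra.
    by move=> _; rewrite mul0r addr0; apply: vw.
  - move=> y yS; rewrite lerBlDr gE; have := vS _ yS.
    have : 0 <= (rank r y < k)%:R * (M - w) by rewrite mulr_ge0// subr_ge0.
    have := mulr_ge0 l0 (run_ge0 (R := R) k (rank r y)).
    by lra.
rewrite -/(rank r x) -/j; by lra.
Qed.
End Bounds.

(** * Expected time to halve the distance to the sink *)

Lemma grid_orientation_swap (A B : finType) (H : A -> rel B) (V : B -> rel A) :
  grid_orientation H V -> grid_orientation V H.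
Proof.
case=> oH oV sinks cyc; split=> // c c' r r'.
  by apply: contra (sinks r r' c c') => /and4P[-> -> -> ->].
by apply: contra (cyc r' r c c') => /and4P[-> -> -> ->].
Qed.

Definition grid_closed (A B : finType) (H : A -> rel B) (V : B -> rel A)
    (D : A -> B -> bool) : Prop :=
  (forall a b b', D a b -> H a b b' -> D a b') /\
  (forall a a' b, D a b -> V b a a' -> D a' b).

(* A supersolution for the time the walk needs to get from the closed set [D']
   into the closed set [D], which contains the box [Rs * Cs] of side at least
   [k / 2], when in [D'] one of the two ranks is always less than [k]. Outside
   [D] all of [Rs] or all of [Cs] lies below the current vertex. The constant
   125 accounts for the worst case; the smaller ones are values at vertices from
   which, once the larger rank has dropped to [O(k)], [D] (for 100) or a vertex
   of the previous kind is reached with probability bounded from below. *)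
Definition phase_time (R : realFieldType) (A B : finType) (H : A -> rel B)
    (V : B -> rel A) (D D' : A -> B -> bool) (Rs : {set A}) (Cs : {set B})
    (k : nat) (eta : R) (a : A) (b : B) : R :=
  let i := rank (H a) b in
  let j := rank (V b) a in
  if D a b then 0 else if ~~ D' a b then 125 * eta else
  (if (b \in Cs) && (i < k)%N || (a \in Rs) && (j < k)%N then 100 * eta
   else if (k <= i)%N && ~~ (Cs \subset [set y | H a b y])
        || (k <= j)%N && ~~ (Rs \subset [set y | V b a y]) then 119 * eta
   else 124 * eta) + 2 * (run k i + run k j).

Lemma phase_time_swap (R : realFieldType) (A B : finType) (H : A -> rel B)
    (V : B -> rel A) (D D' : A -> B -> bool) (Rs : {set A}) (Cs : {set B})
    (k : nat) (eta : R) (a : A) (b : B) :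
  phase_time V H (fun b a => D a b) (fun b a => D' a b) Cs Rs k eta b a =
  phase_time H V D D' Rs Cs k eta a b.
Proof.
rewrite /phase_time orbC [in X in if X then 119 * _ else _]orbC.
by rewrite [run _ (rank (V b) a) + _]addrC.
Qed.

(** Otherwise some box cell [(a', b')] spans with [(a, b)] a square in which [(a, b)] is a sink. An
    arc from [(a', b')] inside the square would lead on to [(a, b)], which is outside the closed set
    [D]; so [(a', b')] is a second sink. *)
Lemma box_escape (A B : finType) (H : A -> rel B) (V : B -> rel A)
    (D : A -> B -> bool) (Rs : {set A}) (Cs : {set B}) (a : A) (b : B) :
  grid_orientation H V -> grid_closed H V D ->
  (forall a b, a \in Rs -> b \in Cs -> D a b) -> ~~ D a b ->
  (Rs \subset [set y | V b a y]) || (Cs \subset [set y | H a b y]).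
Proof.
move=> [oH oV sinks _] [DH DV] box nD.
apply/negPn/negP; rewrite negb_or => /andP[/subsetPn[a' a'R + ] /subsetPn[b' b'C]].
rewrite !inE => nV nH.
have Dab' := box _ _ a'R b'C.
have [ea|nea] := eqVneq a a'.
  rewrite -ea in Dab'; have [eb|neb] := eqVneq b b'.
    by rewrite eb Dab' in nD.
  case: (oH a) => _ _ /(_ _ _ neb); rewrite (negbTE nH) /= => h.
  by rewrite (DH _ _ _ Dab' h) in nD.
have va : V b a' a by case: (oV b) => _ _ /(_ _ _ nea); rewrite (negbTE nV).
have [eb|neb] := eqVneq b b'.
  by rewrite -eb in Dab'; rewrite (DV _ _ _ Dab' va) in nD.
have hb : H a b' b by case: (oH a) => _ _ /(_ _ _ neb); rewrite (negbTE nH).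
have /negP := sinks a a' b b'; apply; rewrite hb va /=; apply/andP; split.
  case: (oH a') => _ _ /(_ _ _ neb) /orP[//|h].
  by rewrite (DV _ _ _ (DH _ _ _ Dab' h) va) in nD.
case: (oV b') => _ _ /(_ _ _ nea) /orP[//|h].
by rewrite (DH _ _ _ (DV _ _ _ Dab' h) hb) in nD.
Qed.

Ltac feed rb :=
  match type of rb with ?P -> _ =>
    let h := fresh in assert (h : P); [|specialize (rb h); clear h] end.

Section Phase.
Context {R : realFieldType} {A B : finType} (H : A -> rel B) (V : B -> rel A).
Context (D D' : A -> B -> bool) (Rs : {set A}) (Cs : {set B}) (s : nat) (eta : R).
Local Notation k := (2 * s)%N.
Local Notation psi := (phase_time H V D D' Rs Cs k eta).
Hypothesis oHV : grid_orientation H V.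
Hypothesis Dcl : grid_closed H V D.
Hypothesis D'cl : grid_closed H V D'.
Hypothesis box : forall a b, a \in Rs -> b \in Cs -> D a b.
Hypothesis s_gt0 : (0 < s)%N.
Hypothesis Rs_big : (s <= #|Rs|)%N.
Hypothesis Cs_big : (s <= #|Cs|)%N.
Hypothesis D'thin :
  forall a b, D' a b -> (rank (H a) b < k)%N \/ (rank (V b) a < k)%N.
Hypothesis eta_ge1 : 1 <= eta.
Hypothesis runA : forall t, (t <= #|A|)%N -> 2 * run k t <= eta.
Hypothesis runB : forall t, (t <= #|B|)%N -> 2 * run k t <= eta.

Local Lemma runH a b : 2 * run k (rank (H a) b) <= eta.
Proof. by apply: runB; apply: max_card. Qed.
Local Lemma runV a b : 2 * run k (rank (V b) a) <= eta.
Proof. by apply: runA; apply: max_card. Qed.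

Local Lemma base_bounds a b :
  0 <= 2 * (run k (rank (H a) b) + run k (rank (V b) a)) :> R.
Proof. by rewrite mulr_ge0// addr_ge0// run_ge0. Qed.

Lemma phase_time_bounds a b : 0 <= psi a b <= 125 * eta.
Proof.
have e1 := eta_ge1.
rewrite /phase_time; case: ifP => [_|nD]; first by lra.
case: ifP => [_|/negbFE D'ab]; first by lra.
have := base_bounds a b.
have := runH a b; have := runV a b.
have : run k (rank (H a) b) = 0 :> R \/ run k (rank (V b) a) = 0 :> R.
  by case: (D'thin D'ab) => h; [left|right]; rewrite run_small.
have := run_ge0 (R := R) k (rank (H a) b); have := run_ge0 (R := R) k (rank (V b) a).
by move=> p q; case=> ->; case: ifP => _; [|case: ifP => _| |case: ifP => _]; lra.
Qed.

Local Lemma psi_le_max a b : psi a b <= 125 * eta.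
Proof. by case/andP: (phase_time_bounds a b). Qed.

Local Lemma psi_D a b : D a b -> psi a b = 0.
Proof. by rewrite /phase_time => ->. Qed.

Local Lemma psi_alphaC a b : D' a b -> b \in Cs -> (rank (H a) b < k)%N ->
  psi a b <= 100 * eta + 2 * run k (rank (V b) a).
Proof.
move=> D'ab bC i; rewrite /phase_time bC i /= D'ab (run_small i) add0r.
case: ifP => // _; have := eta_ge1; have := run_ge0 (R := R) k (rank (V b) a); lra.
Qed.

Local Lemma psi_alphaR a b : D' a b -> a \in Rs -> (rank (V b) a < k)%N ->
  psi a b <= 100 * eta + 2 * run k (rank (H a) b).
Proof.
move=> D'ab aR j; rewrite /phase_time aR j orbT D'ab (run_small j) addr0.
case: ifP => // _; have := eta_ge1; have := run_ge0 (R := R) k (rank (H a) b); lra.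
Qed.

Local Lemma rowirr a b : H a b b = false.
Proof. by case: oHV => /(_ a) []. Qed.

Local Lemma escape a b : ~~ D a b ->
  (Rs \subset [set y | V b a y]) || (Cs \subset [set y | H a b y]).
Proof. exact: box_escape. Qed.

(* Half of the cases; the others follow by exchanging rows and columns. *)
Lemma phase_time_half a b : D' a b -> ~~ D a b ->
  [|| (b \in Cs) && (rank (H a) b < k)%N,
      ~~ ((a \in Rs) && (rank (V b) a < k)%N) && (k <= rank (H a) b)%N |
      ~~ ((a \in Rs) && (rank (V b) a < k)%N) &&
      (rank (H a) b < k)%N && (rank (V b) a < k)%N] ->
  ((rank (H a) b)%:R + (rank (V b) a)%:R) +
  (\sum_(y in [set y | H a b y]) psi a y + \sum_(y in [set y | V b a y]) psi y b)
  <= ((rank (H a) b)%:R + (rank (V b) a)%:R) * psi a b.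
Proof.
move=> D'ab nD; case: Dcl => DH DV; case: D'cl => D'H D'V.
have [oH oV _ _] := oHV.
have e1 := eta_ge1; have esc := escape nD.
have sk : (s%:R : R) * 2 = k%:R by rewrite mulrC natrM.
set i := rank (H a) b; set j := rank (V b) a => cases.
have s0 : 0 < s%:R :> R by rewrite ltr0n.
have i0 : 0 <= i%:R :> R by []. have j0 : 0 <= j%:R :> R by [].
have row_max : \sum_(y in [set y | H a b y]) psi a y <= i%:R * (125 * eta).
  rewrite /i /rank mulr_natl -sumr_const; apply: ler_sum => y _; apply: psi_le_max.
have col_max : \sum_(y in [set y | V b a y]) psi y b <= j%:R * (125 * eta).
  rewrite /j /rank mulr_natl -sumr_const; apply: ler_sum => y _; apply: psi_le_max.
(* A vertex of the first kind costs [100 * eta], and its [run] term adds at most [eta]. *)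
have colR y : (j < k)%N -> y \in Rs -> V b a y -> psi y b <= 101 * eta.
  move=> jk yR vy; have := runH y b; have := @psi_alphaR y b (D'V _ _ _ D'ab vy) yR.
  by move=> /(_ (ltn_trans (rank_lt (oV b) vy) jk)); lra.
have rowC y : (i < k)%N -> y \in Cs -> H a b y -> psi a y <= 101 * eta.
  move=> ik yC hy; have := runV a y; have := @psi_alphaC a y (D'H _ _ _ D'ab hy) yC.
  by move=> /(_ (ltn_trans (rank_lt (oH a) hy) ik)); lra.
have [/andP[bC ik]|nalpha] := boolP ((b \in Cs) && (i < k)%N).
  (* The column [b] belongs to the box and does not lie below itself, so the escape is along the
     column, where it leads directly into [D]. *)
  have RV : Rs \subset [set y | V b a y].
    case/orP: esc => // /fintype.subsetP /(_ b bC); by rewrite inE rowirr.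
  have psiE : psi a b = 100 * eta + 2 * run k j.
    by rewrite /phase_time (negbTE nD) D'ab bC ik /= -/i -/j (run_small ik) add0r.
  have psiR y : y \in Rs -> psi y b <= 0 by move=> yR; rewrite psi_D// box.
  have ikR : (i%:R : R) <= s%:R * 2 by rewrite sk ler_nat ltnW.
  rewrite psiE; have [jk|kj] := ltnP j k.
    rewrite (run_small jk) mulr0 addr0.
    have jkR : (j%:R : R) <= s%:R * 2 by rewrite sk ler_nat ltnW.
    have := pick_bound RV Rs_big (M := 125 * eta) (p := 0) (val := psi^~ b).
    rewrite -/(rank (V b) a) -/j => /(_ _ _ psiR).
    have -> : 0 <= 125 * eta by lra.
    move=> /(_ isT (fun y _ => psi_le_max y b)) colb.
    have : (i%:R + j%:R) * (25 * eta + 1) <= s%:R * 4 * (25 * eta + 1).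
      by apply: ler_wpM2r; lra.
    have : s%:R <= s%:R * eta by rewrite ler_peMr// ltW.
    by lra.
  (* The box gains [100 * eta * s]. One half pays [25 * eta] for each of the [2 * s] small ranks of
     the column, the other half pays the same for each of the at most [2 * s] out-neighbours in the
     row. The slope 2 yields [2 * j], which is at least [i + j]. *)
  have := @run_bound R A (V b) a Rs (psi^~ b) k s (100 * eta) (125 * eta) 0 2
    (oV b) kj RV Rs_big (ler0n _ 2) _ _ psiR.
  have -> : 100 * eta <= 125 * eta by lra. have -> : 0 <= 100 * eta by lra.
  move=> /(_ isT isT (fun y _ _ => psi_le_max y b)).
  rewrite -/j => rb; feed rb.
    move=> y vy yR ky; have D'y := D'V _ _ _ D'ab vy.
    apply: psi_alphaC => //; case: (D'thin D'y) => // h.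
    by have := leq_trans h ky; rewrite ltnn.
  have : 0 <= i%:R * run k j :> R by rewrite mulr_ge0// run_ge0.
  have : 0 <= (s%:R * 2 - i%:R) * eta by rewrite mulr_ge0//; lra.
  have : (i%:R : R) <= j%:R by rewrite ler_nat (leq_trans (ltnW ik) kj).
  by move: rb; rewrite -sk; lra.
move: cases; rewrite (negbTE nalpha) /=.
have [/andP[nalpha' ki] _|ncase2 /=] :=
    boolP (~~ ((a \in Rs) && (j < k)%N) && (k <= i)%N).
  have jk : (j < k)%N.
    by case: (D'thin D'ab) => //; rewrite -/i ltnNge ki.
  have aR : a \notin Rs by rewrite jk andbT in nalpha'.
  have ki' : (i < k)%N = false by rewrite ltnNge ki.
  have kj' : (k <= j)%N = false by rewrite leqNgt jk.
  have psiE : psi a b = (if ~~ (Cs \subset [set y | H a b y]) then 119 * eta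
                         else 124 * eta) + 2 * run k i.
    rewrite /phase_time (negbTE nD) D'ab (negbTE aR) -/i -/j ki ki' kj' andbF /=.
    by rewrite (run_small jk) addr0 orbF.
  have run0 : 0 <= j%:R * run k i :> R by rewrite mulr_ge0// run_ge0.
  have jkR : (j%:R : R) <= s%:R * 2 by rewrite sk ler_nat ltnW.
  have jiR : (j%:R : R) <= i%:R by rewrite ler_nat (leq_trans (ltnW jk) ki).
  have smallr y : H a b y -> (k <= rank (H a) y)%N -> (rank (V y) a < k)%N.
    move=> hy ky; case: (D'thin (D'H _ _ _ D'ab hy)) => // h.
    by have := leq_trans h ky; rewrite ltnn.
  have rowE y : H a b y -> (k <= rank (H a) y)%N ->
      psi a y <= (if ~~ (Cs \subset [set z | H a y z]) then 119 * eta
                  else 124 * eta) + 2 * run k (rank (H a) y).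
    move=> hy ky; have jy := smallr _ hy ky; rewrite /phase_time.
    case: ifP => _; first by have := run_ge0 (R := R) k (rank (H a) y); case: ifP; lra.
    rewrite (D'H _ _ _ D'ab hy) (negbTE aR) ky ltnNge ky /= andbF /=.
    by rewrite (leqNgt k (rank (V y) a)) jy /= orbF (run_small jy) addr0.
  have sub y : H a b y -> [set z | H a y z] \subset [set z | H a b z].
    move=> hy; apply/fintype.subsetP => z; rewrite !inE; case: (oH a) => _ tr _.
    exact: tr.
  rewrite psiE; have [CH|CH] := boolP (Cs \subset [set y | H a b y]) => /=.
    (* A column of the box does not lie below itself, so a vertex in a box column has factor 100 if
       its row rank is small and at most 119 otherwise, up to one more [eta] for [run]. *)
    have valC y : y \in Cs -> psi a y <= 120 * eta.
      move=> yC; have hy : H a b y by have := fintype.subsetP CH _ yC; rewrite inE.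
      have [yk|ky] := ltnP (rank (H a) y) k.
        have := psi_alphaC (D'H _ _ _ D'ab hy) yC yk; have := runV a y; lra.
      have := rowE _ hy ky; have := runH a y.
      have -> : (Cs \subset [set z | H a y z]) = false.
        by apply/negbTE/subsetPn; exists y; rewrite // inE rowirr.
      by move=> /=; lra.
    (* The gain [4 * eta * s] matches a loss of [eta] for each of the [2 * s] small ranks and for
       each of the at most [2 * s] out-neighbours in the column. *)
    have := @run_bound R B (H a) b Cs (psi a) k s (124 * eta) (125 * eta)
      (120 * eta) 2 (oH a) ki CH Cs_big (ler0n _ 2) _ _ valC.
    have -> : 124 * eta <= 125 * eta by lra. have -> : 120 * eta <= 124 * eta by lra.
    move=> /(_ isT isT (fun y _ _ => psi_le_max a y)).
    rewrite -/i => rb; feed rb.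
      by move=> y hy _ ky; have := rowE y hy ky; case: ifP => _; lra.
    have : 0 <= (s%:R * 2 - j%:R) * eta by rewrite mulr_ge0//; lra.
    by move: rb; rewrite -sk; lra.
  have RV : Rs \subset [set y | V b a y] by move: esc; rewrite (negbTE CH) orbF.
  have valR y : y \in Rs -> psi y b <= 101 * eta.
    by move=> yR; apply: colR => //; have := fintype.subsetP RV _ yR; rewrite inE.
  have := pick_bound RV Rs_big (M := 125 * eta) (val := psi^~ b) _ _ valR.
  rewrite -/(rank (V b) a) -/j.
  have -> : 101 * eta <= 125 * eta by lra.
  move=> /(_ isT (fun y _ => psi_le_max y b)) colb.
  (* The row offers no gain, hence the empty set. The column gains [24 * eta * s], matching a loss
     of [6 * eta] for each of the [2 * s] small ranks of the row and each of the at most [2 * s]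
     out-neighbours in the column. *)
  have := @run_bound R B (H a) b finset.set0 (psi a) k 0 (119 * eta) (125 * eta)
      (119 * eta) 2 (oH a) ki (finset.sub0set _) (leq0n _) (ler0n _ 2).
  have -> : 119 * eta <= 125 * eta by lra.
  move=> /(_ isT (lexx _)) /(_ _ (fun y _ _ => psi_le_max a y)).
  rewrite -/i => rb; feed rb; first by move=> y; rewrite inE.
  feed rb.
    move=> y hy _ ky; have := rowE y hy ky; case: ifP => //= /negbFE CHy.
    by rewrite (fintype.subset_trans CHy (sub _ hy)) in CH.
  have : 0 <= (s%:R * 2 - j%:R) * eta by rewrite mulr_ge0//; lra.
  by move: rb; rewrite -sk; lra.
move=> /andP[/andP[nalpha' ik] jk].
have ikR : (i%:R : R) <= s%:R * 2 by rewrite sk ler_nat ltnW.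
have jkR : (j%:R : R) <= s%:R * 2 by rewrite sk ler_nat ltnW.
have psiE : psi a b = 124 * eta.
  rewrite /phase_time (negbTE nD) D'ab -/i -/j (negbTE nalpha) (negbTE nalpha') /=.
  by rewrite (leqNgt k i) (leqNgt k j) ik jk (run_small ik) (run_small jk) /= addr0
    mulr0 addr0.
rewrite psiE.
(* The loss is [eta + 1] per out-neighbour, of which there are at most [4 * s]; either line of the
   box gains [24 * eta * s]. *)
have ij : (i%:R + j%:R) * (eta + 1) <= s%:R * 4 * (eta + 1).
  by apply: ler_wpM2r; lra.
have se : s%:R <= s%:R * eta by rewrite ler_peMr// ltW.
case/orP: esc => [RV|CH].
  have valR y : y \in Rs -> psi y b <= 101 * eta.
    by move=> yR; apply: colR => //; have := fintype.subsetP RV _ yR; rewrite inE.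
  have := pick_bound RV Rs_big (M := 125 * eta) (val := psi^~ b) _ _ valR.
  rewrite -/(rank (V b) a) -/j.
  have -> : 101 * eta <= 125 * eta by lra.
  by move=> /(_ isT (fun y _ => psi_le_max y b)) colb; lra.
have valC y : y \in Cs -> psi a y <= 101 * eta.
  by move=> yC; apply: rowC => //; have := fintype.subsetP CH _ yC; rewrite inE.
have := pick_bound CH Cs_big (M := 125 * eta) (val := psi a) _ _ valC.
rewrite -/(rank (H a) b) -/i.
have -> : 101 * eta <= 125 * eta by lra.
by move=> /(_ isT (fun y _ => psi_le_max a y)) colb; lra.
Qed.

End Phase.

Lemma phase_time_drift (R : realFieldType) (A B : finType) (H : A -> rel B)
    (V : B -> rel A) (D D' : A -> B -> bool) (Rs : {set A}) (Cs : {set B})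
    (s : nat) (eta : R) :
  grid_orientation H V -> grid_closed H V D -> grid_closed H V D' ->
  (forall a b, a \in Rs -> b \in Cs -> D a b) -> (0 < s)%N ->
  (s <= #|Rs|)%N -> (s <= #|Cs|)%N ->
  (forall a b, D' a b ->
     (rank (H a) b < 2 * s)%N \/ (rank (V b) a < 2 * s)%N) ->
  1 <= eta ->
  (forall t, (t <= #|A|)%N -> 2 * run (2 * s) t <= eta) ->
  (forall t, (t <= #|B|)%N -> 2 * run (2 * s) t <= eta) ->
  forall a b, D' a b -> ~~ D a b ->
  ((rank (H a) b)%:R + (rank (V b) a)%:R) +
  (\sum_(y in [set y | H a b y]) phase_time H V D D' Rs Cs (2 * s) eta a y
   + \sum_(y in [set y | V b a y]) phase_time H V D D' Rs Cs (2 * s) eta y b)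
  <= ((rank (H a) b)%:R + (rank (V b) a)%:R)
     * phase_time H V D D' Rs Cs (2 * s) eta a b.
Proof.
move=> oHV Dcl D'cl box s0 Rb Cb thin e1 rA rB a b D'ab nD.
set k := (2 * s)%N in thin rA rB *; pose psi := phase_time H V D D' Rs Cs k eta.
have [h|] := boolP ([|| (b \in Cs) && (rank (H a) b < k)%N,
      ~~ ((a \in Rs) && (rank (V b) a < k)%N) && (k <= rank (H a) b)%N |
      ~~ ((a \in Rs) && (rank (V b) a < k)%N) &&
      (rank (H a) b < k)%N && (rank (V b) a < k)%N]).
  exact: (phase_time_half oHV Dcl D'cl box s0 Rb Cb thin e1 rA rB D'ab nD h).
rewrite !negb_or => /and3P[nalpha ncase2 ncase3].
have swapped : [|| (a \in Rs) && (rank (V b) a < k)%N,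
      ~~ ((b \in Cs) && (rank (H a) b < k)%N) && (k <= rank (V b) a)%N |
      ~~ ((b \in Cs) && (rank (H a) b < k)%N) &&
      (rank (V b) a < k)%N && (rank (H a) b < k)%N].
  move: ncase2 ncase3; rewrite nalpha /= (leqNgt k (rank (V b) a)) (leqNgt k (rank
    (H a) b)).
  case: (a \in Rs); case: (rank (V b) a < k)%N => //=;
    by case: (rank (H a) b < k)%N.
have swp u v : phase_time V H (fun b a => D a b) (fun b a => D' a b) Cs Rs k eta v u
    = psi u v by apply: phase_time_swap.
have thin' v u : D' u v -> (rank (V v) u < k)%N \/ (rank (H u) v < k)%N.
  by move=> /thin[]; [right|left].
have box' v u : v \in Cs -> u \in Rs -> D u v by move=> vC uR; apply: box.
have Dcl' : grid_closed V H (fun b a => D a b).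
  by case: Dcl => DH DV; split=> *; [apply: DV|apply: DH]; eassumption.
have D'cl' : grid_closed V H (fun b a => D' a b).
  by case: D'cl => DH DV; split=> *; [apply: DV|apply: DH]; eassumption.
have := phase_time_half (grid_orientation_swap oHV) Dcl' D'cl' box' s0 Cb Rb
  thin' e1 rB rA D'ab nD swapped.
rewrite -/k swp (addrC (rank (V b) a)%:R); apply: le_trans.
by rewrite lerD2l addrC lerD//; apply: ler_sum => y _; rewrite swp.
Qed.

(** * The nested closed sets and the sum over the phases *)

Section Arcs.
Context {A B : finType} {H : A -> rel B} {V : B -> rel A}.
Hypothesis oHV : grid_orientation H V.

Lemma sum_grid_arc (R : nmodType) (F : A * B -> R) a b :
  \sum_(y | grid_arc H V (a, b) y) F y =
  \sum_(y in [set y | H a b y]) F (a, y) + \sum_(y in [set y | V b a y]) F (y, b).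
Proof.
have [oH oV _ _] := oHV.
have irrH c : H a c c = false by case: (oH a) => ->.
have irrV c : V b c c = false by case: (oV b) => ->.
rewrite (bigID (fun y => y.1 == a)) /=; congr (_ + _).
  rewrite (reindex_onto (pair a) snd) /=; last by case=> u v /= /andP[_ /eqP->].
  apply: eq_bigl => c; rewrite /grid_arc /= inE !eqxx /= andbT.
  by case: eqVneq => [<-|]; rewrite ?irrV ?orbF ?andbT.
rewrite (reindex_onto (fun c => (c, b)) fst) /=; last first.
  by case=> u v; rewrite /grid_arc /= => /andP[/orP[/andP[/eqP-> _]|/andP[/eqP->
    _]]]; rewrite ?eqxx.
apply: eq_bigl => c; rewrite /grid_arc /= inE !eqxx /= andbT irrH andbF /=.
by case: eqVneq => [->|]; rewrite ?irrV ?andbF ?andbT.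
Qed.

Lemma card_grid_arc a b :
  #|[set y | grid_arc H V (a, b) y]| = (rank (H a) b + rank (V b) a)%N.
Proof.
rewrite /rank -!sum1_card; under eq_bigl do rewrite inE.
exact: (sum_grid_arc (fun=> 1%N)).
Qed.

Definition thin (t : nat) (a : A) (b : B) : bool :=
  [forall y, connect (grid_arc H V) (a, b) y ==>
     ~~ ((t <= rank (H y.1) y.2)%N && (t <= rank (V y.2) y.1)%N)].

Lemma thin_closed t : grid_closed H V (thin t).
Proof.
suff cl x y : grid_arc H V x y -> thin t x.1 x.2 -> thin t y.1 y.2.
  split=> [a b b' D h|a a' b D h].
  - by apply: (cl (a, b) (a, b')) D; rewrite /grid_arc /= eqxx h.
  - by apply: (cl (a, b) (a', b)) D; rewrite /grid_arc /= eqxx h orbT.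
move=> xy /forallP D; apply/forallP => z; apply/implyP => yz.
have := D z; rewrite -!surjective_pairing in yz *.
by move=> /implyP; apply; apply: connect_trans yz; apply: connect1.
Qed.

Lemma thin_rank t a b :
  thin t a b -> (rank (H a) b < t)%N \/ (rank (V b) a < t)%N.
Proof.
move=> /forallP /(_ (a, b)); rewrite connect0 /= negb_and -!ltnNge.
by move=> /orP.
Qed.

(** If both two-arc paths failed, [(a, b')] and [(a', b)] would be two sinks of the square. *)
Lemma connect_box a b a' b' :
  V b a a' -> H a b b' -> connect (grid_arc H V) (a, b) (a', b').
Proof.
move=> v h; have [oH oV sinks _] := oHV.
have : H a' b b' || V b' a a'.
  rewrite -[X in is_true X]negbK; apply/negP; rewrite negb_or => /andP[nh nv].
  have neb : b != b' by apply: contraTneq h => <-; case: (oH a) => ->.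
  have nea : a != a' by apply: contraTneq v => <-; case: (oV b) => ->.
  have := sinks a a' b' b; rewrite h v /=.
  have [_ _ /(_ _ _ neb)] := oH a'; rewrite (negbTE nh) /= => ->.
  by have [_ _ /(_ _ _ nea)] := oV b'; rewrite (negbTE nv) /= => ->.
case/orP=> e.
- apply: (@connect_trans _ _ (a', b)); apply: connect1; rewrite /grid_arc /= !eqxx.
    by rewrite v orbT.
  by rewrite e.
- apply: (@connect_trans _ _ (a, b')); apply: connect1; rewrite /grid_arc /= !eqxx.
    by rewrite h.
  by rewrite e orbT.
Qed.

(* The box is spanned by the out-neighbours of a vertex with both ranks at least
   [t] from which no other such vertex can be reached. *)
Lemma thin_box t a b : ~~ thin t a b ->
  exists (Rs : {set A}) (Cs : {set B}),
    [/\ (t <= #|Rs|)%N, (t <= #|Cs|)%N &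
        forall a b, a \in Rs -> b \in Cs -> thin t a b].
Proof.
pose fat (y : A * B) := (t <= rank (H y.1) y.2)%N && (t <= rank (V y.2) y.1)%N.
move=> /forallPn[y0]; rewrite negb_imply negbK => /andP[_ fat0].
have [v fatv vmin] := @arg_minnP _ y0 fat (fun y => #|connect (grid_arc H V) y|) fat0.
(* A [y] of this kind reaches, by minimality, no fewer cells than [v], hence exactly the same ones
   and among them [v]; acyclicity concludes. *)
have only y : connect (grid_arc H V) v y -> fat y -> y = v.
  move=> vy fy; apply: (grid_acyclic oHV) => //.
  suff /fintype.subsetP/(_ v (connect0 _ _)) :
      connect (grid_arc H V) v \subset connect (grid_arc H V) y by [].
  have sub : connect (grid_arc H V) y \subset connect (grid_arc H V) v.
    by apply/fintype.subsetP => z yz; apply: connect_trans vy yz.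
  have [_ <-] := subset_leqif_card sub.
  by rewrite eqn_leq vmin// subset_leq_card.
case/andP: fatv => vi vj.
exists [set y | V v.2 v.1 y], [set y | H v.1 v.2 y]; split=> // a' b'.
rewrite !inE => va' hb'; apply/forallP => z; apply/implyP => az; apply/negP => fz.
have vb : connect (grid_arc H V) v (a', b').
  by rewrite [v]surjective_pairing; apply: connect_box.
have zv : z = v by apply: only => //; apply: connect_trans az.
rewrite zv in az; have := grid_acyclic oHV vb az => e.
by move: va'; rewrite e /=; have [_ oV _ _] := oHV; case: (oV b') => ->.
Qed.
End Arcs.

Section Levels.
Context {A B : finType} {H : A -> rel B} {V : B -> rel A}.
Hypothesis oHV : grid_orientation H V.
Context (s0 : A * B).
Hypothesis s0_sink : forall y, ~~ grid_arc H V s0 y.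

(** Level 0 is the target and not [thin 1], which may also contain cells with one positive rank. The
    sink is its own box, of side 1. *)
Definition level (l : nat) (a : A) (b : B) : bool :=
  if l is 0%N then (a, b) == s0 else thin (H := H) (V := V) (2 ^ l) a b.

Lemma level_closed l : grid_closed H V (level l).
Proof.
case: l => [|l]; last exact: thin_closed.
split=> [a b b'|a a' b] /eqP e h.
  by have := s0_sink (a, b'); rewrite -e /grid_arc /= eqxx h.
by have := s0_sink (a', b); rewrite -e /grid_arc /= eqxx h orbT.
Qed.

Lemma level_box l a b : ~~ level l a b ->
  exists (Rs : {set A}) (Cs : {set B}),
    [/\ (2 ^ l <= #|Rs|)%N, (2 ^ l <= #|Cs|)%N &
        forall a b, a \in Rs -> b \in Cs -> level l a b].
Proof.
case: l => [_|l]; last exact: thin_box.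
exists [set s0.1], [set s0.2]; rewrite !cards1; split=> // a' b'.
by rewrite !inE /level => /eqP-> /eqP->; rewrite -surjective_pairing.
Qed.

Context {R : realFieldType} (eta : R).
Hypothesis eta_ge1 : 1 <= eta.
Hypothesis run_eta : forall k t, (0 < k)%N -> (t <= maxn #|A| #|B|)%N ->
  2 * run k t <= eta.

(** Multiplication by the out-degree keeps the inequality meaningful at the sink. The cost [c] is 1
    where a phase is active and 0 elsewhere. *)
Local Definition drift (c : R) (psi : A -> B -> R) a b :=
  ((rank (H a) b)%:R + (rank (V b) a)%:R) * c +
  (\sum_(y in [set y | H a b y]) psi a y + \sum_(y in [set y | V b a y]) psi y b)
  <= ((rank (H a) b)%:R + (rank (V b) a)%:R) * psi a b.

Local Lemma level_time l : exists psi : A -> B -> R,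
  (forall a b, 0 <= psi a b <= 125 * eta) /\
  forall a b, drift 0 psi a b /\ (level l.+1 a b -> ~~ level l a b -> drift 1 psi a b).
Proof.
have e1 := eta_ge1.
have [/forallP all|/forallPn[[a0 b0] /= nall]] :=
    boolP [forall x : A * B, level l x.1 x.2].
  exists (fun _ _ => 0); split=> [a b|a b]; first by rewrite lexx /=; lra.
  rewrite /drift !big1 ?addr0 ?mulr0//; split=> //.
  by rewrite (all (a, b)).
have [Rs [Cs [Rb Cb box]]] := level_box nall.
have D'thin a b : level l.+1 a b ->
    (rank (H a) b < 2 * 2 ^ l)%N \/ (rank (V b) a < 2 * 2 ^ l)%N.
  by rewrite -expnS; apply: thin_rank.
have l0 : (0 < 2 ^ l)%N by rewrite expn_gt0.
have k0 : (0 < 2 * 2 ^ l)%N by rewrite muln_gt0.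
have rA t : (t <= #|A|)%N -> 2 * run (2 * 2 ^ l) t <= eta.
  by move=> tA; apply: run_eta => //; rewrite leq_max tA.
have rB t : (t <= #|B|)%N -> 2 * run (2 * 2 ^ l) t <= eta.
  by move=> tA; apply: run_eta => //; rewrite leq_max tA orbT.
have Dcl := level_closed l; have D'cl := level_closed l.+1.
set psi := phase_time H V (level l) (level l.+1) Rs Cs (2 * 2 ^ l) eta.
have bnd a b : 0 <= psi a b <= 125 * eta by apply: phase_time_bounds.
exists psi; split=> // a b.
have full : level l.+1 a b -> ~~ level l a b -> drift 1 psi a b.
  move=> D'ab nD; rewrite /drift mulr1.
  exact: (phase_time_drift oHV Dcl D'cl box l0 Rb Cb D'thin e1 rA rB D'ab nD).
split=> //.
have sum0 : 0 <= ((rank (H a) b)%:R + (rank (V b) a)%:R) :> R by rewrite addr_ge0.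
have [Dab|nD] := boolP (level l a b).
  case: Dcl => DH DV.
  rewrite /drift mulr0 add0r {3}/psi /phase_time Dab mulr0.
  rewrite !big1 ?addr0// => y; rewrite inE => h; rewrite /psi /phase_time.
    by rewrite (DV _ _ _ Dab h).
  by rewrite (DH _ _ _ Dab h).
have [D'ab|nD'] := boolP (level l.+1 a b).
  apply: le_trans (full D'ab nD); rewrite mulr0 mulr1 add0r.
  by rewrite lerDr.
(* Outside [level l.+1] the function takes its upper bound, so no average exceeds it. *)
have psiE : psi a b = 125 * eta by rewrite /psi /phase_time (negbTE nD) nD'.
rewrite /drift mulr0 add0r psiE mulrDl /rank !mulr_natl -!sumr_const lerD//.
  by apply: ler_sum => y _; have /andP[_] := bnd a y; rewrite mulr_natl.
by apply: ler_sum => y _; have /andP[_] := bnd y b; rewrite mulr_natl.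
Qed.

Lemma walk_time (L : nat) : (maxn #|A| #|B| < 2 ^ L)%N ->
  exists Psi : A * B -> R,
    (forall x, 0 <= Psi x <= L%:R * (125 * eta)) /\
    forall x, x != s0 ->
      (0 < #|[set y | grid_arc H V x y]|)%N /\
      1 + (\sum_(y | grid_arc H V x y) Psi y) / #|[set y | grid_arc H V x y]|%:R
      <= Psi x.
Proof.
move=> big.
have [psi [bnd dr]] : exists psi : A -> B -> R,
    (forall a b, 0 <= psi a b <= L%:R * (125 * eta)) /\
    forall a b, drift 0 psi a b /\
      (~~ level 0 a b -> level L a b -> drift 1 psi a b).
  elim: L {big} => [|L [psi [bnd dr]]].
    exists (fun _ _ => 0); split=> a b; first by rewrite mul0r lexx.
    rewrite /drift !big1 ?addr0 ?mulr0//; split=> // n0 l0.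
    by rewrite l0 in n0.
  have [phi [bphi dphi]] := level_time L.
  exists (fun a b => psi a b + phi a b); split=> a b.
    have /andP[p1 p2] := bnd a b; have /andP[q1 q2] := bphi a b.
    by rewrite addr_ge0//= -natr1 mulrDl mul1r lerD.
  have plus c c' : drift c psi a b -> drift c' phi a b ->
      drift (c + c') (fun a b => psi a b + phi a b) a b.
    rewrite /drift !big_split /= !mulrDr => h h'; apply: le_trans (lerD h h') => //.
    by rewrite le_eqVlt; apply/orP; left; apply/eqP; ring.
  have [dr0 dr1] := dr a b; have [dp0 dp1] := dphi a b.
  split; first by rewrite -[0]addr0; apply: plus.
  (* Either an earlier phase already charges the cell, or it lies in [level L.+1] but not in
     [level L] and the new phase does. *)
  move=> n0 l1; have [lL|nL] := boolP (level L a b).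
    by rewrite -[1]addr0; apply: plus => //; apply: dr1.
  by rewrite -[1]add0r; apply: plus => //; apply: dp1.
have L0 : (0 < L)%N.
  case: (L) big => //; rewrite expn0 ltnS leqn0 => /eqP e.
  by have := leq_maxl #|A| #|B|; rewrite e; case: (s0) => a _;
    rewrite leqn0 => /eqP /card0_eq /(_ a).
exists (fun x => psi x.1 x.2); split=> [x|[a b] /= xs0]; first exact: bnd.
have [_ /(_ xs0)] := dr a b.
(* All ranks are below [2 ^ L], so the last level is the whole grid. *)
have -> : level L a b.
  rewrite /level; case: (L) L0 big => // l _ big; apply/forallP => y.
  apply/implyP => _; rewrite negb_and -!ltnNge; apply/orP; left.
  apply: leq_ltn_trans big; rewrite leq_max; apply/orP; right; exact: max_card.
move=> /(_ isT) dab.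
have [Rs [Cs [Rb Cb box]]] : exists (Rs : {set A}) (Cs : {set B}),
    [/\ (2 ^ 0 <= #|Rs|)%N, (2 ^ 0 <= #|Cs|)%N &
        forall a b, a \in Rs -> b \in Cs -> level 0 a b] := level_box (l := 0) xs0.
have pos : (0 < rank (H a) b + rank (V b) a)%N.
  rewrite addn_gt0 /rank.
  by case/orP: (box_escape oHV (level_closed 0) box xs0) => /subset_leq_card h;
    rewrite (leq_trans _ h) ?orbT.
rewrite card_grid_arc// (sum_grid_arc oHV); split=> //.
have p : 0 < (rank (H a) b + rank (V b) a)%:R :> R by rewrite ltr0n.
rewrite -(ler_pM2l p) mulrDr mulr1 mulrCA divff ?lt0r_neq0// mulr1.
by move: dab; rewrite /drift mulr1 -natrD.
Qed.
End Levels.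

(** * Facets of a polytope *)

Section Inner.
Local Open Scope classical_set_scope.
Context {R : realType} {m : nat}.
Implicit Types (c x y : 'rV[R]_m) (U : {vspace 'rV[R]_m}).

Lemma innerDr c x y : inner c (x + y) = inner c x + inner c y.
Proof. by rewrite -big_split /=; apply: eq_bigr => i _; rewrite mxE mulrDr. Qed.

Lemma innerZr c (t : R) x : inner c (t *: x) = t * inner c x.
Proof. by rewrite mulr_sumr; apply: eq_bigr => i _; rewrite mxE mulrCA. Qed.

Lemma innerNr c x : inner c (- x) = - inner c x.
Proof. by rewrite -scaleN1r innerZr mulN1r. Qed.

Lemma innerBr c x y : inner c (x - y) = inner c x - inner c y.
Proof. by rewrite innerDr innerNr. Qed.

Lemma innerC c x : inner c x = inner x c.
Proof. by apply: eq_bigr => i _; rewrite mulrC. Qed.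

Lemma inner0l x : inner 0 x = 0.
Proof. by apply: big1 => i _; rewrite mxE mul0r. Qed.

Lemma inner_suml (I : Type) (r : seq I) (P : pred I) (F : I -> 'rV[R]_m) x :
  inner (\sum_(i <- r | P i) F i) x = \sum_(i <- r | P i) inner (F i) x.
Proof.
elim/big_rec2: _ => [|i u c _ <-]; first exact: inner0l.
by rewrite innerC innerDr -!(innerC _ x).
Qed.

Lemma inner_sumr (I : Type) (r : seq I) (P : pred I) (F : I -> 'rV[R]_m) x :
  inner x (\sum_(i <- r | P i) F i) = \sum_(i <- r | P i) inner x (F i).
Proof. by rewrite innerC inner_suml; apply: eq_bigr => i _; rewrite innerC. Qed.

Definition inner_hom c : 'Hom('rV[R]_m, R^o) := linfun (fun x => inner c x : R^o).

Lemma inner_homE c x : inner_hom c x = inner c x.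
Proof.
have lin : linear (fun x => inner c x : R^o).
  by move=> t u v; rewrite innerDr innerZr.
pose f : {linear 'rV[R]_m -> R^o} := HB.pack (fun x => inner c x : R^o)
  (GRing.isLinear.Build _ _ _ _ _ lin).
exact: (lfunE f).
Qed.

Definition hyperplane c : {vspace 'rV[R]_m} := lker (inner_hom c).

Lemma mem_hyperplane c x : (x \in hyperplane c) = (inner c x == 0).
Proof. by rewrite memv_ker inner_homE. Qed.

Lemma dim_cap_hyperplane U c : (\dim U <= (\dim (U :&: hyperplane c)).+1)%N.
Proof.
rewrite -(limg_ker_dim (inner_hom c) U) -[X in (_ <= X)%N]addn1 leq_add2l.
by apply: (leq_trans (dimvS (subvf _))); rewrite dimvf.
Qed.

Lemma dim_cap_hyperplane_proper U c x : x \in U -> inner c x != 0 ->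
  (\dim (U :&: hyperplane c)).+1 = \dim U.
Proof.
move=> xU cx; apply/eqP; rewrite eqn_leq dim_cap_hyperplane andbT.
have [le eq] := dimv_leqif_sup (capvSl U (hyperplane c)).
rewrite ltn_neqAle le andbT eq; apply: contra cx => /subvP /(_ x xU).
by rewrite memv_cap mem_hyperplane => /andP[].
Qed.

Lemma inner_step (s : seq ('rV[R]_m * R)) x u : exists2 e : R, 0 < e &
  forall h, h \in s -> inner h.1 x < h.2 -> forall t, `|t| <= e ->
    inner h.1 (x + t *: u) < h.2.
Proof.
elim: s => [|h s [e e0 IH]]; first by exists 1.
have [hx|hx] := ltP (inner h.1 x) h.2; last first.
  exists e => // h'; rewrite inE => /orP[/eqP->|]; last exact: IH.
  by rewrite ltNge hx.
have d0 : 0 < 1 + `|inner h.1 u| by rewrite ltr_wpDr.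
exists (Num.min e ((h.2 - inner h.1 x) / (1 + `|inner h.1 u|))).
  by rewrite lt_min e0 divr_gt0// subr_gt0.
move=> h'; rewrite inE => /orP[/eqP->|h's] h'x t; rewrite le_min => /andP[te tb].
  rewrite innerDr innerZr -ltrBrDl; apply: le_lt_trans (ler_norm _) _.
  rewrite normrM; move: tb; rewrite ler_pdivlMr// mulrDr mulr1 => tb.
  have [->|tn] := eqVneq t 0; first by rewrite normr0 mul0r subr_gt0.
  by apply: lt_le_trans tb; rewrite ltrDr normr_gt0.
exact: IH.
Qed.

Lemma affine_hull_local (Q : set 'rV[R]_m) x U : Q x ->
  (forall q, Q q -> q - x \in U) ->
  (forall u, u \in U -> exists2 e : R, 0 < e & Q (x + e *: u)) ->
  affine_hull Q = [set x + u | u in [set` U]].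
Proof.
move=> Qx QU UQ; apply/seteqP; split=> y.
  move=> [k [p [a [pQ a1 ->]]]]; exists (\sum_(i < k) a i *: (p i - x)).
    by apply: rpred_sum => i _; apply: rpredZ; apply: QU.
  under eq_bigr do rewrite scalerBr.
  by rewrite sumrB -scaler_suml a1 scale1r addrC subrK.
move=> [u /= uU <-]; have [e e0 Qe] := UQ _ uU.
(* These weights extrapolate the short step [e *: u] to the full step [u]. *)
exists 2%N, (fun i => if i == 0 then x else x + e *: u),
  (fun i => if i == 0 then 1 - e^-1 else e^-1); split.
- by move=> i; case: ifP.
- by rewrite big_ord_recl big_ord1 /= subrK.
- rewrite big_ord_recl big_ord1 /= scalerDr scalerA mulVf ?gt_eqF// scale1r.
  by rewrite scalerBl scale1r addrA subrK.
Qed.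

Lemma has_dim_local (Q : set 'rV[R]_m) x U k : Q x ->
  (forall q, Q q -> q - x \in U) ->
  (forall u, u \in U -> exists2 e : R, 0 < e & Q (x + e *: u)) ->
  has_dim Q k <-> \dim U = k.
Proof.
move=> Qx QU UQ; have aff := affine_hull_local Qx QU UQ; split; last first.
  by move=> Uk; exists x, U.
move=> [x0 [U0 [aff0 <-]]]; congr (\dim _).
rewrite aff in aff0; apply/vspaceP => u.
have xE : [set x0 + u | u in [set` U0]] x by rewrite -aff0; exists 0;
  rewrite /= ?mem0v ?addr0.
case: xE => w /= wU0 xw.
apply/idP/idP => uU.
  have : [set x0 + u | u in [set` U0]] (x + u) by rewrite -aff0; exists u.
  move=> [w' /= w'U0 e].
  have -> : u = w' - w by apply: (addrI x); rewrite -e -xw -addrA [w + _]addrC subrK.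
  exact: rpredB.
have : [set x + u | u in [set` U]] (x0 + (w + u)).
  by rewrite aff0; exists (w + u) => //=; apply: rpredD.
by move=> [w' /= w'U]; rewrite addrA xw => /addrI <-.
Qed.

Lemma bounded_no_ray (Q : set 'rV[R]_m) x y : bounded_set Q -> y != 0 ->
  ~ (forall t : R, 0 <= t -> Q (x + t *: y)).
Proof.
move=> [M0 [_ QM0]] y0 ray; pose M := `|M0| + 1.
have QM z : Q z -> `|z| <= M.
  by apply: QM0; rewrite /M (le_lt_trans (ler_norm M0))// ltrDl.
have ny : 0 < `|y| by rewrite normr_gt0.
pose t := (`|M| + `|x| + 1) / `|y|.
have t0 : 0 <= t by rewrite divr_ge0// !addr_ge0.
have := QM _ (ray t t0); apply/negP; rewrite -ltNge.
have : `|t *: y| <= `|x + t *: y| + `|x|.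
  by rewrite -[X in `|X| <= _](addKr x) addrC; apply: le_trans (ler_normB _ _) _;
    rewrite addrC.
rewrite normrZ ger0_norm// /t divfK ?gt_eqF//.
have := ler_norm M; lra.
Qed.

Lemma vertex_in (Q : set 'rV[R]_m) x : vertex Q x -> Q x.
Proof. by case=> c [r [_ /seteqP[+ _]]] => /(_ x erefl)[]. Qed.

Lemma vertex_rigid (Q : set 'rV[R]_m) x y (e : R) : vertex Q x -> 0 < e ->
  (forall t, `|t| <= e -> Q (x + t *: y)) -> y = 0.
Proof.
move=> [c [r [le /seteqP[xr rx]]]] e0 eQ; have [_ /= cx] := xr x erefl.
have ee : `|e| <= e by rewrite gtr0_norm.
have p1 := le _ (eQ e ee); have p2 := le _ (eQ (- e) _).
rewrite normrN !innerDr !innerZr cx in p1 p2; have {}p2 := p2 ee.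
have cy : e * inner c y = 0 by lra.
have /= : [set x] (x + e *: y).
  by apply: rx; split; [apply: eQ|rewrite /= innerDr innerZr cy addr0].
by rewrite -[RHS]addr0 => /addrI/eqP; rewrite scaler_eq0 gt_eqF//= => /eqP.
Qed.

End Inner.

Lemma exists_minimal_seq (T : eqType) (s : seq T) (Q : seq T -> Prop) :
  Q s -> (forall l, Q l -> Q (undup l)) ->
  exists l, [/\ Q l, uniq l & forall u : T, u \in l -> ~ Q [seq x <- l | x != u]].
Proof.
move=> Qs Qu.
have ex : exists k, `[< exists2 l, size l = k & Q l >].
  by exists (size s); apply/asboolP; exists s.
case: (ex_minnP ex) => k /asboolP[l lk Ql] min; exists l.
have low l' : Q l' -> (k <= size l')%N by move=> Ql'; apply: min; apply/asboolP;
  exists l'.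
split=> //.
  rewrite -[uniq l]negbK -ltn_size_undup lk ltnNge negbK; exact: low (Qu _ Ql).
move=> u u_l /low; rewrite -lk size_filter leqNgt => /negP; apply.
rewrite -(count_predC (fun x => x != u) l) -[X in (X < _)%N]addn0 ltn_add2l -has_count.
by apply/hasP; exists u; rewrite //= negbK eqxx.
Qed.

(** * Irredundant systems of inequalities *)

Section Facets.
Local Open Scope classical_set_scope.
Local Open Scope card_scope.

Lemma card_image_seq (T : choiceType) (U : Type) (f : T -> U) (l : seq T) (n : nat) :
  uniq l -> {in l &, injective f} -> f @` [set` l] #= `I_n -> size l = n.
Proof.
move=> ul fi fl.
have : [set` l] #= `I_n.
  apply: card_eq_trans fl; rewrite card_eq_sym; apply: inj_card_eq.
  by move=> x y; rewrite !inE; apply: fi.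
have -> : [set` l] = [set` [fset x in l]%fset].
  by apply/seteqP; split=> x /=; rewrite inE.
by move=> /card_fset_set; rewrite set_fsetK card_fseq undup_id.
Qed.

Context {R : realType} {m : nat}.
Implicit Types (P F : set 'rV[R]_m) (h : 'rV[R]_m * R) (x y : 'rV[R]_m).

Lemma inner_segment (c x y : 'rV[R]_m) (t : R) :
  inner c (x + t *: (y - x)) = (1 - t) * inner c x + t * inner c y.
Proof. by rewrite innerDr innerZr innerBr; ring. Qed.

(** This gives a relative interior point: a midpoint is strict in every inequality that is strict at
    one of its ends. Only closure under midpoints is asked for, so that faces are covered too. *)
Lemma strict_point P (s : seq ('rV[R]_m * R)) : P !=set0 ->
  (forall x y, P x -> P y -> P (x + 2^-1 *: (y - x))) ->
  (forall h x, h \in s -> P x -> inner h.1 x <= h.2) ->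
  exists2 x, P x & forall h, h \in s ->
    (forall y, P y -> inner h.1 y = h.2) \/ inner h.1 x < h.2.
Proof.
move=> P0 mid; elim: s => [|h s IH] Ps; first by case: P0 => x Px; exists x.
have [|x Px xs] := IH; first by move=> h' x hs; apply: Ps; rewrite inE hs orbT.
have [tight|] := pselect (forall y, P y -> inner h.1 y = h.2).
  by exists x => // h'; rewrite inE => /orP[/eqP->|]; [left|apply: xs].
move=> /existsNP[y /not_implyP[Py /eqP yh]].
have le_h h' z : h' \in h :: s -> P z -> inner h'.1 z <= h'.2 by apply: Ps.
have half : 0 < (2 : R)^-1 by rewrite invr_gt0.
have e2 : (2 : R)^-1 * 2 = 1 by rewrite mulVf.
exists (x + 2^-1 *: (y - x)); first exact: mid.
move=> h' h's; rewrite inner_segment.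
have hx := le_h _ _ h's Px; have hy := le_h _ _ h's Py.
move: h's; rewrite inE => /orP[/eqP e|h's].
  right; rewrite e in hx hy *.
  have : inner h.1 y < h.2 by rewrite lt_neqAle yh.
  by nra.
case: (xs _ h's) => [|lt]; first by left.
by right; nra.
Qed.

Definition kernel (s : seq ('rV[R]_m * R)) : {vspace 'rV[R]_m} :=
  (\bigcap_(h <- s) hyperplane h.1)%VS.

Lemma mem_kernel s x : (x \in kernel s) = all (fun h => inner h.1 x == 0) s.
Proof.
rewrite /kernel; elim: s => [|h s IH]; first by rewrite big_nil memvf.
by rewrite big_cons memv_cap mem_hyperplane IH.
Qed.

(** Inequalities that hold with equality on all of [P] are absorbed into [L]. Each remaining one is
    certified by a point [z] of the affine hull that violates it alone. *)
Definition irredundant P (x0 : 'rV[R]_m) (L : {vspace 'rV[R]_m})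
    (sys : seq ('rV[R]_m * R)) : Prop :=
  [/\ forall x, P x <-> x - x0 \in L /\ forall h, h \in sys -> inner h.1 x <= h.2,
      P x0 /\ forall h, h \in sys -> inner h.1 x0 < h.2, uniq sys &
      forall h, h \in sys -> exists z, [/\ z - x0 \in L, h.2 < inner h.1 z &
        forall h', h' \in sys -> h' != h -> inner h'.1 z <= h'.2]].

Lemma exists_irredundant P : polytope P -> P !=set0 ->
  exists x0 L sys, irredundant P x0 L sys.
Proof.
move=> [_ [s Ps]] P0.
have Ph h x : h \in s -> P x -> inner h.1 x <= h.2 by move=> hs; rewrite Ps; apply.
have mid x y : P x -> P y -> P (x + 2^-1 *: (y - x)).
  rewrite Ps => Px Py h hs; rewrite inner_segment.
  have := Px h hs; have := Py h hs.
  have : (2 : R)^-1 * 2 = 1 by rewrite mulVf.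
  have : 0 < (2 : R)^-1 by rewrite invr_gt0.
  by nra.
have [x0 Px0 x0s] := strict_point P0 mid Ph.
pose implicit h := `[< forall y, P y -> inner h.1 y = h.2 >].
pose L := kernel [seq h <- s | implicit h].
have PL x : P x -> x - x0 \in L.
  move=> Px; rewrite mem_kernel; apply/allP => h;
    rewrite mem_filter => /andP[/asboolP ih _].
  by rewrite innerBr ih// ih// subrr.
pose Q (l : seq ('rV[R]_m * R)) := {subset l <= [seq h <- s | ~~ implicit h]} /\
  forall x, x - x0 \in L -> (forall h, h \in l -> inner h.1 x <= h.2) -> P x.
have Q0 : Q [seq h <- s | ~~ implicit h].
  split=> // x xL xs; rewrite Ps => h hs.
  have [ih|nih] := boolP (implicit h); last by apply: xs; rewrite mem_filter nih.
  have : inner h.1 (x - x0) == 0.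
    by move: xL; rewrite mem_kernel => /allP; apply; rewrite mem_filter ih.
  rewrite innerBr subr_eq0 => /eqP->; exact: Ph.
have Qu l : Q l -> Q (undup l).
  move=> [sub suf]; split=> [h|x xL xs]; first by rewrite mem_undup; apply: sub.
  by apply: suf => // h hl; apply: xs; rewrite mem_undup.
have [l [[sub suf] ul min]] := exists_minimal_seq Q0 Qu.
have ls h : h \in l -> h \in s by move=> /sub; rewrite mem_filter => /andP[].
have Pl x : P x <-> x - x0 \in L /\ forall h, h \in l -> inner h.1 x <= h.2.
  split=> [Px|[xL xl]]; last exact: suf.
  by split=> [|h /ls hs]; [apply: PL|apply: Ph].
exists x0, L, l; split=> //.
  split=> // h hl; case: (x0s h (ls h hl)) => // tight.
  by have := sub h hl; rewrite mem_filter => /andP[/asboolP].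
move=> h hl; apply: contrapT => nz; apply: (min h hl); split.
  by move=> h'; rewrite mem_filter => /andP[_]; apply: sub.
move=> z zL zl; apply: contrapT => nPz; apply: nz; exists z.
have zl' h' : h' \in l -> h' != h -> inner h'.1 z <= h'.2.
  by move=> h'l ne; apply: zl; rewrite mem_filter /= ne.
split=> //; rewrite ltNge; apply/negP => hz; apply: nPz; apply: suf => // h' h'l.
by have [->|ne] := eqVneq h' h; [|apply: zl'].
Qed.

Definition cut P h : set 'rV[R]_m := P `&` [set x | inner h.1 x = h.2].

Section Irredundant.
Context {P : set 'rV[R]_m} {x0 : 'rV[R]_m} {L : {vspace 'rV[R]_m}}.
Context {sys : seq ('rV[R]_m * R)}.
Hypothesis irr : irredundant P x0 L sys.

Lemma irr_has_dim k : has_dim P k <-> \dim L = k.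
Proof.
case: irr => Pe [Px0 x0s] _ _; apply: (@has_dim_local _ _ P x0 L k Px0).
  by move=> q /Pe[].
move=> u uL; have [e e0 es] := inner_step sys x0 u.
exists e => //; apply/Pe; split; first by rewrite addrC addKr; apply: rpredZ.
by move=> h hs; apply/ltW/(es h hs (x0s h hs)); rewrite ger0_norm// ltW.
Qed.

(** The segment from [x0] to the point violating [h] alone crosses the hyperplane of [h] there;
    strictness of the other inequalities is inherited from [x0]. This is a relative interior point
    of the facet. *)
Lemma cut_point h : h \in sys -> exists w, [/\ P w, inner h.1 w = h.2 &
  forall h', h' \in sys -> h' != h -> inner h'.1 w < h'.2].
Proof.
case: irr => Pe [Px0 x0s] _ viol hs; have [z [zL hz zs]] := viol h hs.
have hx0 := x0s h hs.
pose t := (h.2 - inner h.1 x0) / (inner h.1 z - inner h.1 x0).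
have d0 : 0 < inner h.1 z - inner h.1 x0 by lra.
have t0 : 0 < t by rewrite divr_gt0// subr_gt0.
have t1 : t < 1 by rewrite ltr_pdivrMr// mul1r; lra.
have tE : t * (inner h.1 z - inner h.1 x0) = h.2 - inner h.1 x0 by rewrite divfK
  ?gt_eqF.
have hw : inner h.1 (x0 + t *: (z - x0)) = h.2 by rewrite inner_segment; lra.
have others h' : h' \in sys -> h' != h -> inner h'.1 (x0 + t *: (z - x0)) < h'.2.
  move=> h's ne; rewrite inner_segment.
  have p1 : 0 < (1 - t) * (h'.2 - inner h'.1 x0).
    by rewrite mulr_gt0 ?subr_gt0//; apply: x0s.
  have p2 : 0 <= t * (h'.2 - inner h'.1 z).
    by rewrite mulr_ge0 ?subr_ge0 ?(ltW t0)//; apply: zs.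
  by lra.
exists (x0 + t *: (z - x0)); split=> //; apply/Pe; split.
  by rewrite addrC addKr; apply: rpredZ.
move=> h' h's; have [->|ne] := eqVneq h' h; first by rewrite hw.
exact/ltW/others.
Qed.

Lemma cut_face h : h \in sys -> face P (cut P h).
Proof.
case: irr => Pe _ _ _ hs; exists h.1, h.2; split=> // x /Pe[_]; exact.
Qed.

Lemma cut_dim h k : h \in sys -> has_dim (cut P h) k <-> \dim L = k.+1.
Proof.
move=> hs; case: (irr) => Pe [Px0 x0s] _ viol.
have [w [Pw hw ws]] := cut_point hs.
have [z [zL hz _]] := viol h hs.
have dimE : (\dim (L :&: hyperplane h.1)).+1 = \dim L.
  apply: (dim_cap_hyperplane_proper zL); rewrite innerBr gt_eqF// subr_gt0.
  by apply: lt_trans hz; apply: x0s.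
have wL : w - x0 \in L by case/Pe: Pw.
rewrite -dimE; apply: (iff_trans (@has_dim_local _ _ (cut P h) w (L :&: hyperplane
  h.1)%VS k _ _ _)).
- by split.
- move=> q [/Pe[qL _] /= hq]; rewrite memv_cap mem_hyperplane innerBr hq hw subrr
    eqxx andbT.
  by have -> : q - w = (q - x0) - (w - x0); [rewrite opprB addrA subrK|apply: rpredB].
- move=> u; rewrite memv_cap mem_hyperplane => /andP[uL /eqP hu].
  have [e e0 es] := inner_step sys w u; exists e => //; split=> /=; last first.
    by rewrite innerDr innerZr hu mulr0 addr0.
  apply/Pe; split; first by rewrite addrAC; apply: rpredD => //; apply: rpredZ.
  move=> h' h's; have [->|ne] := eqVneq h' h.
    by rewrite innerDr innerZr hu mulr0 addr0 hw.
  by apply/ltW/(es h' h's (ws h' h's ne)); rewrite ger0_norm// ltW.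
by split=> [->|[]].
Qed.

Lemma cut_facet h : h \in sys -> facet P (cut P h).
Proof.
move=> hs; split; first exact: cut_face.
case E : (\dim L) => [|k]; last first.
  exists k; split; last exact/irr_has_dim.
  exact/cut_dim.
(* In dimension 0 the violating point would be [x0]. *)
have [_ _ _ /(_ h hs)[z [zL hz _]]] := irr.
move/eqP: E; rewrite dimv_eq0 => /eqP L0; move: zL hz.
rewrite L0 memv0 subr_eq0 => /eqP ->; case: irr => _ [_ x0s] _ _.
by have := x0s h hs; lra.
Qed.

Lemma cut_inj : {in sys &, injective (cut P)}.
Proof.
move=> h h' hs h's e; have [w [Pw hw ws]] := cut_point hs.
have : cut P h w by split.
rewrite e => -[_ /= h'w]; apply/eqP/negPn/negP => ne.
have := ws h' h's; rewrite eq_sym => /(_ ne).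
by rewrite h'w ltxx.
Qed.

Lemma facet_cut F : facet P F -> exists2 h, h \in sys & F = cut P h.
Proof.
move=> [[c [b [Pc ->]]] [k [Fk Pk]]]; set F0 := P `&` _ in Fk *.
case: (irr) => Pe [Px0 x0s] _ _.
have F0ne : F0 !=set0.
  case: Fk => x [U [aff _]].
  have : [set x + u | u in [set` U]] (x + 0) by exists 0 => //=; rewrite mem0v.
  rewrite -aff => -[n [p [a [pF a1 _]]]].
  case: n p a pF a1 => [|n] p a pF a1; last by exists (p ord0).
  by move: a1; rewrite big_ord0 => /esym/eqP; rewrite oner_eq0.
have mid x y : F0 x -> F0 y -> F0 (x + 2^-1 *: (y - x)).
  have half : 0 < (2 : R)^-1 by rewrite invr_gt0.
  have e2 : (2 : R)^-1 * 2 = 1 by rewrite mulVf.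
  move=> [/Pe[xL xs] /= cx] [/Pe[yL ys] /= cy]; split.
    apply/Pe; split.
      rewrite addrAC; apply: rpredD => //; apply: rpredZ.
      by have -> : y - x = (y - x0) - (x - x0);
        [rewrite opprB addrA subrK|apply: rpredB].
    by move=> h hs; rewrite inner_segment; have := xs h hs; have := ys h hs; nra.
  by rewrite /= inner_segment cx cy; nra.
have F0s h x : h \in sys -> F0 x -> inner h.1 x <= h.2.
  by move=> hs [/Pe[_ xs] _]; apply: xs.
have [x F0x xs] := strict_point F0ne mid F0s.
have [[h hs tight]|none] :=
    pselect (exists2 h, h \in sys & forall y, F0 y -> inner h.1 y = h.2).
  exists h => //.
  have sub : F0 `<=` cut P h by move=> y F0y; split; [case: F0y|apply: tight].
  apply/seteqP; split=> // y hy.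
  have hull (Q : set 'rV[R]_m) z : Q z -> affine_hull Q z.
    move=> Qz; exists 1%N, (fun=> z), (fun=> 1); split=> //; rewrite big_ord1//.
    by rewrite scale1r.
  have cutk : has_dim (cut P h) k by apply/cut_dim => //; apply/irr_has_dim.
  case: Fk => x1 [U1 [aff1 dim1]]; case: cutk => x2 [U2 [aff2 dim2]].
  have mono : affine_hull F0 `<=` affine_hull (cut P h).
    move=> z [n [p [a [pF a1 ->]]]]; exists n, p, a; split=> // i; exact: sub.
  (* equal dimensions force equal affine hulls, and [inner c] is constant on
     the hull of [F0] *)
  have [w1 /= w1U e1] : [set x2 + u | u in [set` U2]] x1.
    by rewrite -aff2; apply: mono; rewrite aff1; exists 0; rewrite /= ?mem0v ?addr0.
  have U12 : (U1 <= U2)%VS.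
    apply/subvP => u uU1.
    have [w /= wU e] : [set x2 + u | u in [set` U2]] (x1 + u).
      by rewrite -aff2; apply: mono; rewrite aff1; exists u.
    have -> : u = w - w1 by apply: (addrI x1);
      rewrite -e -e1 -addrA [w1 + _]addrC subrK.
    exact: rpredB.
  have U21 : (U2 <= U1)%VS.
    by have [_ <-] := dimv_leqif_sup U12; rewrite dim1 dim2.
  have : affine_hull F0 y.
    have : affine_hull (cut P h) y by apply: hull.
    rewrite aff2 aff1 => -[u /= uU <-]; exists (u - w1) => /=.
      by apply: (subvP U21); apply: rpredB.
    by rewrite -e1 -addrA [w1 + _]addrC subrK.
  move=> [n [p [a [pF a1 yE]]]]; split; first by case: hy.
  rewrite /= yE inner_sumr; under eq_bigr do rewrite innerZr (pF _).2.
  by rewrite -mulr_suml a1 mul1r.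
(* otherwise [F0] meets the relative interior of [P], so [F0 = P] *)
have strict h : h \in sys -> inner h.1 x < h.2.
  by move=> hs; case: (xs h hs) => // tight; case: none; exists h.
have [Px /= cx] := F0x.
have cL u : u \in L -> inner c u = 0.
  move=> uL; have [e e0 es] := inner_step sys x u.
  have in_P t : `|t| <= e -> P (x + t *: u).
    move=> te; apply/Pe; split.
      by rewrite addrAC; apply: rpredD; [case/Pe: Px|apply: rpredZ].
    by move=> h hs; apply: ltW; apply: es => //; apply: strict.
  have := Pc _ (in_P e _); have := Pc _ (in_P (- e) _).
  rewrite normrN (ger0_norm (ltW e0)) !innerDr !innerZr cx.
  by move=> /(_ (lexx _)) p1 /(_ (lexx _)) p2; nra.
have F0P : F0 = P.
  apply/seteqP; split=> [y []//|y Py]; split=> //=.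
  have -> : y = x + (y - x) by rewrite addrC subrK.
  rewrite innerDr (cL (y - x)) ?addr0//.
  have -> : y - x = (y - x0) - (x - x0) by rewrite opprB addrA subrK.
  by apply: rpredB; [case/Pe: Py|case/Pe: Px].
rewrite F0P in Fk; move/irr_has_dim: Fk => Ek; move/irr_has_dim: Pk.
by rewrite Ek => /n_Sn.
Qed.

End Irredundant.

(** The bijection [cut] between inequalities and facets turns simplicity into a count of tight
    inequalities. *)
Lemma simple_polytope_system P (d n : nat) : simple_polytope P d -> P !=set0 ->
  [set F | facet P F] #= `I_n ->
  exists (x0 : 'rV[R]_m) (L : {vspace 'rV[R]_m}) (a : 'I_n -> 'rV[R]_m) (b : 'I_n -> R),
    [/\ P = [set x | x - x0 \in L /\ forall i, inner (a i) x <= b i], \dim L = d &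
        forall v, vertex P v -> #|[pred i | inner (a i) v == b i]| = d].
Proof.
move=> [Ppoly Pd Pv] P0 Fn.
have [x0 [L [sys irr]]] := exists_irredundant Ppoly P0.
have [Pe _ usys _] := irr.
have facetE : [set F | facet P F] = cut P @` [set` sys].
  apply/seteqP; split=> [F /(facet_cut irr)[h hs ->]|_ [h hs <-]]; first by exists h.
  exact: (cut_facet irr).
have sz : size sys = n.
  by apply: (card_image_seq usys (cut_inj irr)); rewrite -facetE.
have tightE v : vertex P v -> size [seq h <- sys | inner h.1 v == h.2] = d.
  move=> vv; have Pvv := vertex_in vv.
  apply: (card_image_seq (filter_uniq _ usys) (f := cut P)).
    move=> h h'; rewrite !mem_filter => /andP[_ hs] /andP[_ h's].
    exact: (cut_inj irr).
  suff -> : cut P @` [set` [seq h <- sys | inner h.1 v == h.2]]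
            = [set F | facet P F /\ F v] by apply: Pv.
  apply/seteqP; split=> [_ [h /= + <-]|F [/(facet_cut irr)[h hs ->] [_ /= hv]]].
    rewrite mem_filter => /andP[/eqP hv hs].
    by split; [apply: (cut_facet irr)|split; first exact: Pvv].
  by exists h; rewrite //= mem_filter hs hv eqxx.
rewrite -sz; exists x0, L, (fun i => (tnth (in_tuple sys) i).1),
  (fun i => (tnth (in_tuple sys) i).2); split.
- apply/seteqP; split=> x /= => [/Pe[xL xs]|[xL xs]].
    by split=> // i; apply: xs; apply: mem_tnth.
  apply/Pe; split=> // h hs; have /tnthP[i ->] : h \in in_tuple sys by [].
  exact: xs.
- by apply/(irr_has_dim irr).
- move=> v vv; rewrite -(tightE v vv) size_filter.
  have -> : count (fun h => inner h.1 v == h.2) sys =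
      count (fun i => inner (tnth (in_tuple sys) i).1 v == (tnth (in_tuple sys) i).2)
        (enum 'I_(size sys)).
    have sysE : sys = [seq tnth (in_tuple sys) i | i <- enum 'I_(size sys)].
      by rewrite map_tnth_enum.
    by rewrite [X in count _ X = _]sysE count_map; apply: eq_count.
  by rewrite -sum1_count -sum1_card big_enum_cond /=.
Qed.

End Facets.

(** * Simple polytopes of corank two are grids *)

(** Every other vertex is adjacent to exactly one end of the edge [f0 g0]. Applying the exchange
    property to an edge from [g0] or [f0] to one of its neighbours decides all remaining pairs. *)
Lemma complete_bipartite (T : finType) (G : rel T) (f0 g0 : T) :
  symmetric G -> irreflexive G -> G f0 g0 ->
  (forall f g h, G f g -> h != f -> h != g -> G f h (+) G g h) ->
  exists A : {set T}, forall f g, G f g = (f \in A) (+) (g \in A).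
Proof.
move=> sym irr fg0 pivot; exists [set h | G g0 h]%SET.
have gf0 : G g0 f0 by rewrite sym.
have compl h : G f0 h = ~~ G g0 h.
  have [->|hf] := eqVneq h f0; first by rewrite irr gf0.
  have [->|hg] := eqVneq h g0; first by rewrite irr fg0.
  by have := pivot _ _ _ fg0 hf hg; case: (G f0 h); case: (G g0 h).
have mixed f g : G g0 f -> ~~ G g0 g -> G f g.
  move=> gf ng; have [->|gg0] := eqVneq g g0; first by rewrite sym.
  have gnf : g != f by apply: contraNneq ng => ->.
  by have := pivot _ _ _ gf gg0 gnf; rewrite (negbTE ng).
move=> f g; rewrite !inE.
have [gf|ngf] := boolP (G g0 f); have [gg|ngg] := boolP (G g0 g) => /=.
- have [->|ne] := eqVneq g f; first exact: irr.
  have gg0 : g != g0 by apply: contraTneq gg => ->; rewrite irr.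
  by have := pivot _ _ _ gf gg0 ne; rewrite gg /= => /negbTE.
- exact: mixed.
- by rewrite sym; apply: mixed.
- have [->|ne] := eqVneq g f; first exact: irr.
  have ff : G f0 f by rewrite compl.
  have fg : G f0 g by rewrite compl.
  have gf0' : g != f0 by apply: contraTneq fg => ->; rewrite irr.
  by have := pivot _ _ _ ff gf0' ne; rewrite fg /= => /negbTE.
Qed.

Section Corank2.
Context {R : realType} {m n d : nat} {P : set 'rV[R]_m}.
Context {x0 : 'rV[R]_m} {L : {vspace 'rV[R]_m}}.
Context {a : 'I_n -> 'rV[R]_m} {b : 'I_n -> R}.
Hypothesis Pe : forall x, P x <-> x - x0 \in L /\ forall i, inner (a i) x <= b i.
Hypothesis Pb : bounded_set P.
Hypothesis dimL : \dim L = d.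
Hypothesis nd : n = d.+2.
Hypothesis tight_card :
  forall v, vertex P v -> #|[pred i | inner (a i) v == b i]| = d.
Implicit Types (v w x y z : 'rV[R]_m) (T : {set 'I_n}) (f g h i j : 'I_n).

(* At a vertex [v], [slack v] is the pair of facets that do not contain [v]. *)
Definition slack v : {set 'I_n} := [set i | inner (a i) v != b i]%SET.
Definition slack_face T : set 'rV[R]_m := fun x => P x /\ slack x \subset T.

Local Lemma tightP v i : i \notin slack v -> inner (a i) v = b i.
Proof. by rewrite inE negbK => /eqP. Qed.

Local Lemma slackP v i : P v -> i \in slack v -> inner (a i) v < b i.
Proof. by move=> /Pe[_ le]; rewrite inE lt_neqAle le andbT. Qed.

Lemma perturb v y : P v -> y \in L ->
  (forall i, i \notin slack v -> inner (a i) y = 0) ->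
  exists2 e : R, 0 < e & forall t, `|t| <= e -> P (v + t *: y).
Proof.
move=> Pv yL tight; have [vL vb] := (Pe v).1 Pv.
have [e e0 es] := inner_step [seq (a i, b i) | i <- enum 'I_n] v y.
exists e => // t te; apply/Pe; split.
  by rewrite addrAC; apply: rpredD => //; apply: rpredZ.
move=> i; have [si|nsi] := boolP (i \in slack v).
  apply: ltW; apply: (es (a i, b i)) te; last exact: slackP.
  by apply/mapP; exists i; rewrite ?mem_enum.
by rewrite innerDr innerZr (tight i nsi) mulr0 addr0.
Qed.

Lemma sub_L x y : P x -> P y -> x - y \in L.
Proof.
move=> /Pe[xL _] /Pe[yL _].
by have -> : x - y = (x - x0) - (y - x0); [rewrite opprB addrA subrK|apply: rpredB].
Qed.

(** The sum of the inequalities outside [T] is tight exactly where each of them is. *)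
Lemma slack_face_face T : face P (slack_face T).
Proof.
exists (\sum_(i | i \notin T) a i), (\sum_(i | i \notin T) b i); split.
  by move=> x /Pe[_ le]; rewrite inner_suml; apply: ler_sum.
apply/seteqP; split=> x [Px].
  move=> sT; split=> //=; rewrite inner_suml; apply: eq_bigr => i iT.
  by apply: tightP; apply: contra iT; apply: (fintype.subsetP sT).
move=> /= /eqP; rewrite inner_suml eq_sym -subr_eq0 -sumrB => /eqP s0; split=> //.
have [_ le] := (Pe x).1 Px.
have ge i : i \notin T -> 0 <= b i - inner (a i) x by rewrite subr_ge0.
have z := psumr_eq0P ge s0.
apply/fintype.subsetP => i; rewrite inE; apply: contraR => iT.
by rewrite eq_sym -subr_eq0 z.
Qed.

Lemma face_between E Q : face P E -> (E `<=` Q)%classic -> (Q `<=` P)%classic ->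
  face Q E.
Proof.
move=> [c [r [le ->]]] EQ QP; exists c, r; split; first by move=> x /QP; apply: le.
apply/seteqP; split=> x; first by move=> Ex; split; [apply: EQ|case: Ex].
by move=> [/QP Px cx]; split.
Qed.

Lemma vertexP v : vertex P v <-> P v /\ forall y, y \in L ->
  (forall i, i \notin slack v -> inner (a i) y = 0) -> y = 0.
Proof.
split=> [vv|[Pv rigid]]; last first.
  rewrite /vertex; suff <- : slack_face (slack v) = [set v]%classic.
    exact: slack_face_face.
  apply/seteqP; split=> x /= => [[Px sx]|->]; last by split.
  apply/eqP; rewrite -subr_eq0; apply/eqP; apply: rigid; first exact: sub_L.
  move=> i nsi; rewrite innerBr (tightP nsi) tightP ?subrr//.
  by apply: contra nsi; apply: (fintype.subsetP sx).
split=> [|y yL tight]; first exact: vertex_in.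
have [e e0 ePy] := perturb (vertex_in vv) yL tight.
exact: vertex_rigid vv e0 ePy.
Qed.

Lemma slack_face_vertex T v :
  vertex (slack_face T) v <-> vertex P v /\ slack v \subset T.
Proof.
split=> [vF|[vv sT]]; last first.
  apply: (face_between vv) => [_ ->|x []//].
  split=> //; exact: vertex_in.
have [Pv sv] := vertex_in vF.
split=> //; apply/vertexP; split=> // y yL tight.
have [e e0 ePy] := perturb Pv yL tight.
have eF t : `|t| <= e -> slack_face T (v + t *: y).
  move=> te; split; first exact: ePy.
  apply: fintype.subset_trans sv; apply/fintype.subsetP => i; rewrite !inE;
    apply: contraNN => /eqP vi.
  by rewrite innerDr innerZr tight ?mulr0 ?addr0 ?vi// inE vi eqxx.
exact: vertex_rigid vF e0 eF.
Qed.

Lemma card_slack v : vertex P v -> #|slack v| = 2.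
Proof.
move=> vv; have := cardC [pred i | inner (a i) v == b i].
rewrite (tight_card vv) card_ord => e.
have -> : #|slack v| = #|[predC [pred i | inner (a i) v == b i]]|.
  by apply: eq_card => i; rewrite !inE.
by move: nd; rewrite -{1}e -addn2 => /addnI.
Qed.

Lemma slack_inj v w : vertex P v -> vertex P w -> slack v = slack w -> v = w.
Proof.
move=> vv vw e; apply/eqP; rewrite -subr_eq0; apply/eqP.
have [Pv rigid] := (vertexP v).1 vv; apply: rigid.
  by apply: sub_L => //; apply: vertex_in.
move=> i ni; rewrite innerBr (tightP ni) tightP ?subrr//.
by rewrite -e.
Qed.

(** These are the directions along [slack_face T]. As [n = d + 2], [dim_orth] bounds their dimension
    below by [#|T| - 2]. *)
Definition orth T : {vspace 'rV[R]_m} :=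
  (L :&: kernel [seq (a i, b i) | i <- enum (~: T)%SET])%VS.

Lemma orthP T y :
  reflect (y \in L /\ forall i, i \notin T -> inner (a i) y = 0) (y \in orth T).
Proof.
rewrite memv_cap mem_kernel; apply: (iffP andP) => -[yL ys]; split=> //.
  move=> i iT; have /allP/(_ (a i, b i)) := ys.
  move=> /(_ _)/eqP; apply; apply/mapP; exists i => //.
  by rewrite mem_enum inE.
apply/allP => h /mapP[i]; rewrite mem_enum inE => iT ->.
by rewrite /= ys.
Qed.

Lemma dim_orth T : (d <= \dim (orth T) + #|~: T|)%N.
Proof.
rewrite /orth cardE -dimL; move: (enum _) => s.
elim: s L => [|i s IH] U /=; first by rewrite /kernel big_nil capvf addn0.
rewrite /kernel big_cons capvA; apply: (leq_trans (dim_cap_hyperplane U (a i))).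
by rewrite addnS ltnS; apply: IH.
Qed.

Lemma slack_mid v w : P v -> P w ->
  P (v + 2^-1 *: (w - v)) /\
  slack (v + 2^-1 *: (w - v)) = (slack v :|: slack w)%SET.
Proof.
move=> Pv Pw; have e2 : (2 : R)^-1 * 2 = 1 by rewrite mulVf.
have half : 0 < (2 : R)^-1 by rewrite invr_gt0.
have [vL vb] := (Pe v).1 Pv; have [wL wb] := (Pe w).1 Pw; split.
  apply/Pe; split; first by rewrite addrAC; apply: rpredD => //; apply: rpredZ;
    apply: sub_L.
  by move=> i; rewrite inner_segment; have := vb i; have := wb i; nra.
apply/setP => i; rewrite !inE inner_segment -negb_and; congr (~~ _).
have := vb i; have := wb i => wi vi.
apply/eqP/andP => [e|[/eqP-> /eqP->]]; last by nra.
by split; apply/eqP; nra.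
Qed.

Section Pivot.
Context {v : 'rV[R]_m} {f g h : 'I_n}.
Hypothesis vv : vertex P v.
Hypothesis vs : slack v = [set f; g]%SET.
Hypothesis fg : f != g.
Hypothesis hf : h != f.
Hypothesis hg : h != g.
Local Notation T := (h |: [set f; g])%SET.

Local Lemma h_tight : inner (a h) v = b h.
Proof. by apply: tightP; rewrite vs !inE negb_or hf. Qed.

Lemma card_pivot : #|T| = 3.
Proof. by rewrite cardsU1 cards2 !inE negb_or hf hg fg. Qed.

(** Three free facets leave a nonzero direction, and if [a h] vanished on it, [v] would not be
    rigid. The value -1 makes it leave the facet [h] inwards. *)
Lemma pivot_direction : exists2 y, y \in orth T & inner (a h) y = -1.
Proof.
have := dim_orth T; rewrite cardsCs finset.setCK card_pivot card_ord => dT.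
have := max_card (mem T); rewrite card_pivot card_ord => n3.
have : (orth T != 0)%VS by rewrite -dimv_eq0; lia.
rewrite -vpick0 => y0; set y := vpick _ in y0.
have yT : y \in orth T by apply: memv_pick.
have hy : inner (a h) y != 0.
  apply: contraNneq y0 => hy; apply/eqP.
  have [_ rigid] := (vertexP v).1 vv; have /orthP[yL ys] := yT.
  apply: rigid => // i; rewrite vs => nfg.
  by have [->//|ih] := eqVneq i h; apply: ys; rewrite in_setU1 negb_or ih.
exists (- (inner (a h) y)^-1 *: y); first exact: rpredZ.
by rewrite innerZr mulNr mulVf.
Qed.

Lemma pivot_unique y z : y \in orth T -> inner (a h) y = -1 -> z \in orth T ->
  z = - inner (a h) z *: y.
Proof.
move=> /orthP[yL ys] hy /orthP[zL zs].
apply/eqP; rewrite -subr_eq0; apply/eqP.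
have [_ rigid] := (vertexP v).1 vv; apply: rigid.
  by apply: rpredB => //; apply: rpredZ.
move=> i; rewrite vs innerBr innerZr => nfg.
have [->|ih] := eqVneq i h; first by rewrite hy mulrN1 opprK subrr.
have iT : i \notin T by rewrite in_setU1 negb_or ih.
by rewrite ys// zs// mulr0 subrr.
Qed.

(** One outcome of a ratio test: along [y] the facet [i] is met no later than [j]. Since exactly two
    facets are missed at the new vertex, [j] is not met at the same time. *)
Lemma pivot_land i j (t : R) y : [set i; j]%SET = [set f; g]%SET ->
  y \in orth T -> inner (a h) y = -1 -> 0 < inner (a i) y ->
  inner (a i) (v + t *: y) = b i -> inner (a j) (v + t *: y) <= b j ->
  exists2 w, vertex P w & slack w = [set j; h]%SET.
Proof.
move=> ij yT hy iy iw jw; have [yL ys] := orthP _ _ yT.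
have Pv := vertex_in vv; have [vL vb] := (Pe v).1 Pv.
have t0 : 0 <= t.
  have := vb i; rewrite -iw innerDr innerZr lerDl.
  by rewrite pmulr_lge0.
pose w := v + t *: y.
have tight k : k \notin [set f; g]%SET -> k != h -> inner (a k) w = b k.
  move=> kfg kh; rewrite /w innerDr innerZr ys ?mulr0 ?addr0.
    by apply: tightP; rewrite vs.
  by rewrite in_setU1 negb_or kh.
have Pw : P w.
  apply/Pe; split; first by rewrite addrAC; apply: rpredD => //; apply: rpredZ.
  move=> k; have [->|kh] := eqVneq k h.
    by rewrite /w innerDr innerZr hy h_tight mulrN1 gerDl oppr_le0.
  have [|kfg] := boolP (k \in [set f; g]%SET); last by rewrite tight.
  by rewrite -ij !inE => /orP[/eqP->|/eqP->//]; rewrite iw.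
have sub : slack w \subset [set j; h]%SET.
  apply/fintype.subsetP => k; apply: contraLR;
    rewrite inE negb_or !inE negbK => /andP[kj kh].
  have [|kfg] := boolP (k \in [set f; g]%SET); last by rewrite tight.
  by rewrite -ij !inE (negbTE kj) orbF => /eqP->; rewrite iw.
have vw : vertex P w.
  apply/vertexP; split=> // z zL zs.
  have zT : z \in orth T.
    apply/orthP; split=> // k; rewrite in_setU1 negb_or => /andP[kh kfg].
    by apply: zs; rewrite inE negbK tight.
  have zE := pivot_unique yT hy zT.
  have zi : inner (a i) z = 0 by apply: zs; rewrite inE negbK iw.
  move: zi; rewrite zE innerZr => /eqP; rewrite mulf_eq0 (gt_eqF iy) orbF => /eqP ->.
  by rewrite scale0r.
exists w => //; apply/eqP; rewrite eqEcard sub (card_slack vw).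
by rewrite cards2; case: (_ != _).
Qed.

(** Only [f] and [g] can stop the ray from [v] along the pivot direction, and one of them does
    because [P] is bounded. *)
Lemma pivot_exists : exists2 w, vertex P w &
  slack w = [set f; h]%SET \/ slack w = [set g; h]%SET.
Proof.
have [y yT hy] := pivot_direction; have [yL ys] := orthP _ _ yT.
have Pv := vertex_in vv; have [vL vb] := (Pe v).1 Pv.
have gfE : [set g; f]%SET = [set f; g]%SET by rewrite finset.setUC.
have [fy|fy] := ltP 0 (inner (a f) y); have [gy|gy] := ltP 0 (inner (a g) y).
- pose tf := (b f - inner (a f) v) / inner (a f) y.
  pose tg := (b g - inner (a g) v) / inner (a g) y.
  have tfE : tf * inner (a f) y = b f - inner (a f) v by rewrite divfK ?gt_eqF.
  have tgE : tg * inner (a g) y = b g - inner (a g) v by rewrite divfK ?gt_eqF.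
  have [le|lt] := leP tf tg.
    have [||w vw sw] := pivot_land (t := tf) (erefl [set f; g]%SET) yT hy fy.
    + by rewrite innerDr innerZr tfE addrC subrK.
    + by rewrite innerDr innerZr; have := ler_wpM2r (ltW gy) le; lra.
    by exists w => //; right.
  have [||w vw sw] := pivot_land (t := tg) gfE yT hy gy.
  + by rewrite innerDr innerZr tgE addrC subrK.
  + by rewrite innerDr innerZr; have := ler_wpM2r (ltW fy) (ltW lt); lra.
  by exists w => //; left.
- pose tf := (b f - inner (a f) v) / inner (a f) y.
  have tfE : tf * inner (a f) y = b f - inner (a f) v by rewrite divfK ?gt_eqF.
  have t0 : 0 <= tf by apply: divr_ge0; [rewrite subr_ge0|exact: ltW].
  have [||w vw sw] := pivot_land (t := tf) (erefl [set f; g]%SET) yT hy fy.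
  + by rewrite innerDr innerZr tfE addrC subrK.
  + by rewrite innerDr innerZr; have := vb g; have := mulr_ge0_le0 t0 gy; lra.
  by exists w => //; right.
- pose tg := (b g - inner (a g) v) / inner (a g) y.
  have tgE : tg * inner (a g) y = b g - inner (a g) v by rewrite divfK ?gt_eqF.
  have t0 : 0 <= tg by apply: divr_ge0; [rewrite subr_ge0|exact: ltW].
  have [||w vw sw] := pivot_land (t := tg) gfE yT hy gy.
  + by rewrite innerDr innerZr tgE addrC subrK.
  + by rewrite innerDr innerZr; have := vb f; have := mulr_ge0_le0 t0 fy; lra.
  by exists w => //; left.
exfalso; have y0 : y != 0.
  by apply/eqP => y0; move: hy; rewrite y0 innerC inner0l => /eqP;
    rewrite eq_sym oppr_eq0 oner_eq0.
apply: (@bounded_no_ray _ _ P v y Pb y0) => t t0; apply/Pe; split.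
  by rewrite addrAC; apply: rpredD => //; apply: rpredZ.
move=> k; rewrite innerDr innerZr; have := vb k => vk.
have [->|kh] := eqVneq k h; first by rewrite hy h_tight; lra.
have [->|kf] := eqVneq k f; first by have := vb f; have := mulr_ge0_le0 t0 fy; lra.
have [->|kg] := eqVneq k g; first by have := vb g; have := mulr_ge0_le0 t0 gy; lra.
by rewrite ys ?mulr0 ?addr0// !inE !negb_or kh kf.
Qed.

(** Both vertices would lie on the pivot ray. As [w] is on [g] and [w'] strictly before it, [w']
    comes first; exchanging [f] and [g], [w] comes first. *)
Lemma pivot_not_both w w' : vertex P w -> vertex P w' ->
  slack w = [set f; h]%SET -> slack w' = [set g; h]%SET -> False.
Proof.
move=> vw vw' sw sw'.
have [y yT hy] := pivot_direction.
have Pv := vertex_in vv; have Pw := vertex_in vw; have Pw' := vertex_in vw'.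
have along u : P u -> slack u \subset T -> h \in slack u ->
    exists2 t, 0 < t & u = v + t *: y.
  move=> Pu su hu; exists (b h - inner (a h) u).
    by rewrite subr_gt0; apply: slackP.
  have zT : u - v \in orth T.
    apply/orthP; split; first exact: sub_L.
    move=> i iT; rewrite innerBr !tightP ?subrr//; last first.
      by apply: contra iT; apply: (fintype.subsetP su).
    by rewrite vs; apply: contra iT => iT; rewrite inE iT orbT.
  have := pivot_unique yT hy zT; rewrite innerBr h_tight opprB => <-.
  by rewrite addrC subrK.
have [||t t0 wE] := along w Pw.
- by rewrite sw; apply/fintype.subsetP => i; rewrite !inE => /orP[]->; rewrite ?orbT.
- by rewrite sw !inE eqxx orbT.
have [||t' t'0 w'E] := along w' Pw'.
- by rewrite sw'; apply/fintype.subsetP => i; rewrite !inE => /orP[]->; rewrite ?orbT.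
- by rewrite sw' !inE eqxx orbT.
have gw : inner (a g) w = b g by apply: tightP;
  rewrite sw !inE negb_or eq_sym fg eq_sym.
have fw' : inner (a f) w' = b f by apply: tightP; rewrite sw' !inE negb_or fg eq_sym.
have fw : inner (a f) w < b f by apply: slackP => //; rewrite sw !inE eqxx.
have gw' : inner (a g) w' < b g by apply: slackP => //; rewrite sw' !inE eqxx.
have fv : inner (a f) v < b f by apply: slackP => //; rewrite vs !inE eqxx.
have gv : inner (a g) v < b g by apply: slackP => //; rewrite vs !inE eqxx orbT.
rewrite wE !innerDr !innerZr in gw fw; rewrite w'E !innerDr !innerZr in fw' gw'.
have fy : 0 < inner (a f) y by rewrite -(pmulr_rgt0 _ t'0); lra.
have gy : 0 < inner (a g) y by rewrite -(pmulr_rgt0 _ t0); lra.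
have : t' * inner (a g) y < t * inner (a g) y by lra.
have : t * inner (a f) y < t' * inner (a f) y by lra.
by rewrite !ltr_pM2r// => /lt_trans h1 /h1; rewrite ltxx.
Qed.

(** The edge is [slack_face T], with the midpoint of [v] and [w] as a relative interior point.
    Adjacency is needed inside every larger face, because sinks are taken face by face. *)
Lemma pivot_adjacent w (T' : {set 'I_n}) : vertex P w -> slack w = [set f; h]%SET ->
  T \subset T' -> Defs.adjacent (slack_face T') v w.
Proof.
move=> vw sw TT'; have [y yT hy] := pivot_direction.
have Pv := vertex_in vv; have Pw := vertex_in vw.
have vT : slack v \subset T by rewrite vs finset.subsetUr.
have wT : slack w \subset T.
  by rewrite sw; apply/fintype.subsetP => i; rewrite !inE => /orP[]->; rewrite ?orbT.
have sT u : slack u \subset T -> slack u \subset T' by move=> h1;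
  apply: fintype.subset_trans TT'.
have E0 : face (slack_face T') (slack_face T).
  apply: (face_between (slack_face_face T)) => x []//.
  by move=> Px sx; split=> //; apply: sT.
split.
- move=> e; have : h \in slack w by rewrite sw !inE eqxx orbT.
  by rewrite -e vs !inE (negbTE hf) (negbTE hg).
- by apply/slack_face_vertex; split=> //; apply: sT.
- by apply/slack_face_vertex; split=> //; apply: sT.
exists (slack_face T); last by split; split.
split=> //.
have [Pm sm] := slack_mid Pv Pw; set x := v + _ in Pm sm.
have sx : slack x = T.
  by rewrite sm vs sw; apply/setP => i; rewrite !inE; case: (i == f);
    case: (i == g); case: (i == h).
apply/(@has_dim_local _ _ _ x (<[y]>)%VS 1).
- by split=> //; rewrite sx.
- move=> q [Pq sq]; apply/vlineP; exists (- inner (a h) (q - x)).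
  apply: pivot_unique => //; apply/orthP; split; first exact: sub_L.
  move=> i iT; rewrite innerBr !tightP ?subrr// ?sx//.
  by apply: contra iT; apply: (fintype.subsetP sq).
- move=> _ /vlineP[k ->]; have /orthP[yL ys] := yT.
  have [|i isx|e e0 eP] := @perturb x (k *: y) Pm.
  + exact: rpredZ.
  + by rewrite innerZr ys ?mulr0// -sx.
  exists e => //; split; first by apply: eP; rewrite gtr0_norm.
  apply/fintype.subsetP => i; apply: contraLR => iT.
  rewrite inE negbK innerDr !innerZr ys// !mulr0 addr0; apply/eqP.
  by apply: tightP; rewrite sx.
rewrite dim_vline; case: eqP => // y0; move: hy.
by rewrite y0 innerC inner0l => /eqP; rewrite eq_sym oppr_eq0 oner_eq0.
Qed.

End Pivot.

(** If the slack sets were disjoint, the midpoint of the edge would miss four facets. The at least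
    two-dimensional space [orth T] would then consist of directions of the edge. *)
Lemma adjacent_share u w : Defs.adjacent P u w ->
  exists2 i, i \in slack u & i \in slack w.
Proof.
move=> [_ vu vw [E [[c [r [le Ee]]] [x1 [U1 [aff dim1]]]] [Eu Ew]]].
apply: contrapT => disj.
have Pu := vertex_in vu; have Pw := vertex_in vw.
set T := (slack u :|: slack w)%SET.
have T4 : #|T| = 4.
  rewrite cardsU !card_slack//; suff -> : (slack u :&: slack w = finset.set0)%SET.
    by rewrite cards0.
  apply/setP => i; rewrite finset.in_setI finset.in_set0; apply/negP => /andP[iu iw].
  by apply: disj; exists i.
have dT : (2 <= \dim (orth T))%N.
  have := dim_orth T; have := max_card (mem T);
    rewrite cardsCs finset.setCK T4 card_ord nd.
  lia.
have [x [Px sx cx]] : exists x, [/\ P x, slack x = T & inner c x = r].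
  have [Px sx] := slack_mid Pu Pw; exists (u + 2^-1 *: (w - u)); split=> //.
  move: Eu Ew; rewrite Ee => -[_ /= cu] [_ /= cw].
  rewrite inner_segment cu cw; ring.
have hull (Q : set 'rV[R]_m) z : Q z -> affine_hull Q z.
  move=> Qz; exists 1%N, (fun=> z), (fun=> 1); split=> //; rewrite big_ord1//.
  by rewrite scale1r.
have Ex : E x by rewrite Ee; split.
have : (orth T <= U1)%VS.
  apply/subvP => y /orthP[yL ys].
  have [|e e0 eP] := perturb Px yL; first by rewrite sx.
  have p1 := le _ (eP e _); have p2 := le _ (eP (- e) _).
  rewrite normrN gtr0_norm// !innerDr !innerZr cx in p1 p2.
  have {}p1 := p1 (lexx _); have {}p2 := p2 (lexx _).
  have cy : e * inner c y = 0 by lra.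
  have Exy : E (x + e *: y).
    rewrite Ee; split; first by apply: eP; rewrite gtr0_norm.
    by rewrite /= innerDr innerZr cy addr0.
  have := hull _ _ Exy; have := hull _ _ Ex;
    rewrite aff => -[w1 /= w1U e1] [w2 /= w2U e2].
  have : e *: y \in U1.
    have -> : e *: y = w2 - w1.
      by apply: (addrI x); rewrite -e2 -e1 -addrA [w1 + _]addrC subrK.
    exact: rpredB.
  by move=> /(rpredZ e^-1); rewrite scalerA mulVf ?gt_eqF// scale1r.
by move=> /dimvS; rewrite dim1 => /(leq_trans dT).
Qed.

Lemma slack_bipartite v0 : vertex P v0 -> exists A : {set 'I_n}, forall f g,
  (exists2 v, vertex P v & slack v = [set f; g]%SET) <-> (f \in A) (+) (g \in A).
Proof.
move=> vv0; pose G f g := `[< exists2 v, vertex P v & slack v = [set f; g]%SET >].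
have irr : irreflexive G.
  move=> f; apply/asboolP => -[v vv sv]; have := card_slack vv.
  by rewrite sv finset.setUid cards1.
have sym : symmetric G.
  by move=> f g; apply/asboolP/asboolP => -[v vv sv]; exists v => //;
    rewrite sv finset.setUC.
have /eqP/cards2P[f0 [g0 [_ s0]]] := card_slack vv0.
have fg0 : G f0 g0 by apply/asboolP; exists v0.
have [f g h|A GA] := complete_bipartite sym irr fg0; last first.
  by exists A => f g; rewrite -GA; split=> /asboolP.
move=> Gfg hf hg; have fg : f != g by apply: contraTneq Gfg => ->; rewrite irr.
have /asboolP[v vv sv] := Gfg.
have [w vw sw] := pivot_exists vv sv fg hf hg.
have [/asboolP[w1 vw1 sw1]|/asboolP nf] := boolP (G f h);
  have [/asboolP[w2 vw2 sw2]|/asboolP ng] := boolP (G g h) => //=.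
  by have := pivot_not_both vv sv fg hf hg vw1 vw2 sw1 sw2.
by case: sw => sw; [case: nf|case: ng]; exists w.
Qed.

Section Grid.
Context {A : {set 'I_n}}.
Hypothesis AP : forall f g,
  (exists2 v, vertex P v & slack v = [set f; g]%SET) <-> (f \in A) (+) (g \in A).
Context {arc : 'rV[R]_m -> 'rV[R]_m -> Prop}.
Hypothesis uso : unique_sink_orientation P arc.
Local Notation rows := {i : 'I_n | i \in A}.
Local Notation cols := {i : 'I_n | i \notin A}.

Definition pos (x : rows * cols) : 'rV[R]_m :=
  xget 0 (fun v => vertex P v /\ slack v = [set val x.1; val x.2]%SET).

Local Lemma posP (x : rows * cols) : vertex P (pos x) /\ slack (pos x) = [set val
  x.1; val x.2]%SET.
Proof.
have /AP[v vv sv] : (val x.1 \in A) (+) (val x.2 \in A).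
  by rewrite (valP x.1) (negbTE (valP x.2)).
pose Q u := vertex P u /\ slack u = [set val x.1; val x.2]%SET.
exact: (@xgetPex _ 0 Q (ex_intro Q v (conj vv sv))).
Qed.

Local Lemma row_col (r : rows) (c : cols) : val r != val c.
Proof. by apply: contraTneq (valP r) => ->; exact: (valP c). Qed.

Local Lemma pos_sub (x : rows * cols) T :
  (slack (pos x) \subset T) = (val x.1 \in T) && (val x.2 \in T).
Proof. by have [_ ->] := posP x; rewrite finset.subUset !finset.sub1set. Qed.

Lemma pos_inj : injective pos.
Proof.
move=> [r c] [r' c'] e; have [_] := posP (r, c); have [_] := posP (r', c').
rewrite e => -> /= /setP sE.
have rr : val r = val r'.
  by have := sE (val r); rewrite !inE eqxx /= (negbTE (row_col r c')) orbF => /eqP.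
have cc : val c = val c'.
  have := sE (val c); rewrite !inE eqxx orbT eq_sym [val c == _]eq_sym.
  by rewrite (negbTE (row_col r' c)) /= => /eqP ->.
by congr (_, _); apply: val_inj.
Qed.

Lemma vertex_pos v : vertex P v <-> exists x : rows * cols, v = pos x.
Proof.
split=> [vv|[x ->]]; last by case: (posP x).
have /eqP/cards2P[f [g [fg sv]]] := card_slack vv.
have : (f \in A) (+) (g \in A) by apply/AP; exists v.
wlog fA : f g fg sv / f \in A.
  move=> wl; case: (boolP (f \in A)) => [fA|nfA /= gA].
    by have := wl f g fg sv fA; rewrite fA.
  apply: (wl g f); rewrite 1?eq_sym// ?gA ?(negbTE nfA)//.
  by rewrite sv finset.setUC.
rewrite fA /= => gA; exists (exist _ f fA, exist _ g gA).
have [vp sp] := posP (exist _ f fA, exist _ g gA).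
by apply: slack_inj => //; rewrite sp sv.
Qed.

Lemma row_adjacent (r : rows) (c c' : cols) T : c != c' ->
  val r \in T -> val c \in T -> val c' \in T ->
  Defs.adjacent (slack_face T) (pos (r, c)) (pos (r, c')).
Proof.
move=> cc rT cT c'T; have [v1 s1] := posP (r, c); have [v2 s2] := posP (r, c').
apply: (pivot_adjacent v1 s1 _ _ _ v2 s2); rewrite /= ?row_col//.
- by rewrite eq_sym row_col.
- by rewrite eq_sym; apply: contraNneq cc => /val_inj ->.
- by rewrite !finset.subUset !finset.sub1set c'T rT.
Qed.

Lemma col_adjacent (r r' : rows) (c : cols) T : r != r' ->
  val r \in T -> val r' \in T -> val c \in T ->
  Defs.adjacent (slack_face T) (pos (r, c)) (pos (r', c)).
Proof.
move=> rr rT r'T cT; have [v1 s1] := posP (r, c); have [v2 s2] := posP (r', c).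
rewrite finset.setUC in s1; rewrite finset.setUC in s2.
apply: (pivot_adjacent v1 s1 _ _ _ v2 s2); rewrite /= ?row_col//.
- by rewrite eq_sym row_col.
- by rewrite eq_sym; apply: contraNneq rr => /val_inj ->.
- by rewrite !finset.subUset !finset.sub1set r'T rT cT.
Qed.

Local Lemma slack_faceT : slack_face finset.setT = P.
Proof. by apply/seteqP; split=> x; [case|move=> Px; split=> //;
  apply: finset.subsetT]. Qed.

Local Lemma arcN u w : arc u w -> ~ arc w u.
Proof.
by case: uso => -[arcA arcO] _ uw wu; case: (arcO u w (arcA _ _ uw)) => -[].
Qed.

Local Lemma arc_irr u : ~ arc u u.
Proof. by move=> uu; apply: (arcN uu uu). Qed.

Local Lemma arc_tot u w : Defs.adjacent P u w -> arc u w \/ arc w u.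
Proof. by case: uso => -[_ arcO] _ /arcO[[]|[]]; [left|right]. Qed.

Local Lemma arc_share (x y : rows * cols) : arc (pos x) (pos y) -> x.1 = y.1 \/ x.2
  = y.2.
Proof.
case: uso => -[arcA _] _ /arcA/adjacent_share[i].
have [_ ->] := posP x; have [_ ->] := posP y; rewrite !inE.
move=> /orP[]/eqP-> /orP[]/eqP e.
- by left; apply: val_inj.
- by have := row_col x.1 y.2; rewrite e eqxx.
- by have := row_col y.1 x.2; rewrite e eqxx.
- by right; apply: val_inj.
Qed.

Definition arcH (r : rows) : rel cols :=
  fun c c' => `[< arc (pos (r, c)) (pos (r, c')) >].
Definition arcV (c : cols) : rel rows :=
  fun r r' => `[< arc (pos (r, c)) (pos (r', c)) >].

Lemma arc_pos (x y : rows * cols) : arc (pos x) (pos y) <-> grid_arc arcH arcV x y.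
Proof.
case: x y => [r c] [r' c']; rewrite /grid_arc /=; split.
  move=> h; case: (arc_share h) => /= e; subst.
    by rewrite eqxx; apply/orP; left; apply/asboolP.
  by apply/orP; right; rewrite eqxx; apply/asboolP.
by move=> /orP[]/andP[/eqP<- /asboolP].
Qed.

Local Definition face_sink T := sink (vertex (slack_face T))
  (fun u w => arc u w /\ Defs.adjacent (slack_face T) u w).

Local Lemma face_sink_exists T (x : rows * cols) : val x.1 \in T -> val x.2 \in T ->
  exists y : rows * cols, [/\ val y.1 \in T, val y.2 \in T & face_sink T (pos y)].
Proof.
move=> x1 x2; case: uso => _ /(_ _ (slack_face_face T)) [].
  by exists (pos x); split; [apply: vertex_in; case: (posP x)|rewrite pos_sub x1].
move=> v [sv _]; have [/slack_face_vertex[/vertex_pos[y ey]]] := sv.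
by rewrite ey pos_sub => /andP[y1 y2] _; exists y; rewrite -ey.
Qed.

Local Lemma arcH_ne r c c' : arcH r c c' -> c != c'.
Proof. by move=> /asboolP h; apply/eqP => e; rewrite e in h; apply: arc_irr h. Qed.
Local Lemma arcV_ne r c c' : arcV r c c' -> c != c'.
Proof. by move=> /asboolP h; apply/eqP => e; rewrite e in h; apply: arc_irr h. Qed.

Local Lemma not_sinkH T r c c' : val r \in T -> val c \in T -> val c' \in T ->
  arcH r c c' -> ~ face_sink T (pos (r, c)).
Proof.
move=> rT cT c'T h [_ /(_ (pos (r, c')))]; apply; split; first exact/asboolP.
by apply: row_adjacent => //; apply: arcH_ne h.
Qed.

Local Lemma not_sinkV T r r' c : val r \in T -> val r' \in T -> val c \in T ->
  arcV c r r' -> ~ face_sink T (pos (r, c)).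
Proof.
move=> rT r'T cT h [_ /(_ (pos (r', c)))]; apply; split; first exact/asboolP.
by apply: col_adjacent => //; apply: arcV_ne h.
Qed.

(** If transitivity failed, three cells of the row would form a directed triangle, a face without a
    sink. *)
Local Lemma arcH_total r : strict_total (arcH r).
Proof.
have tot c c' : c != c' -> arcH r c c' || arcH r c' c.
  move=> ne; have := @row_adjacent r c c' finset.setT ne (finset.in_setT _)
    (finset.in_setT _) (finset.in_setT _).
  by rewrite slack_faceT => /arc_tot[] h; apply/orP; [left|right]; apply/asboolP.
split=> //; first by move=> c; apply/asboolP; apply: arc_irr.
move=> c2 c1 c3 h12 h23; have [e|ne] := eqVneq c1 c3.
  by move/asboolP: h12; move/asboolP: h23; rewrite e => h23 /(arcN h23).
have [//|h31] := orP (tot _ _ ne).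
pose T := [set val r; val c1; val c2; val c3]%SET.
have rT : val r \in T by rewrite !inE eqxx.
have T1 : val c1 \in T by rewrite !inE eqxx ?orbT.
have T2 : val c2 \in T by rewrite !inE eqxx ?orbT.
have T3 : val c3 \in T by rewrite !inE eqxx ?orbT.
have [[r' c'] [/= r'T c'T]] := @face_sink_exists T (r, c1) rT T1.
have -> : r' = r.
  apply: val_inj; move: r'T; rewrite !inE !(negbTE (row_col _ _)) !orbF.
  by move=> /eqP.
have : c' \in [:: c1; c2; c3].
  rewrite !inE; move: c'T; rewrite !inE [val c' == val r]eq_sym (negbTE (row_col _
    _)) /=.
  by rewrite !val_eqE -orbA.
rewrite !inE => /or3P[]/eqP->; by [move/(not_sinkH rT T1 T2 h12)|
  move/(not_sinkH rT T2 T3 h23)|move/(not_sinkH rT T3 T1 h31)].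
Qed.

Local Lemma arcV_total c : strict_total (arcV c).
Proof.
have tot r r' : r != r' -> arcV c r r' || arcV c r' r.
  move=> ne; have := @col_adjacent r r' c finset.setT ne (finset.in_setT _)
    (finset.in_setT _) (finset.in_setT _).
  by rewrite slack_faceT => /arc_tot[] h; apply/orP; [left|right]; apply/asboolP.
split=> //; first by move=> r; apply/asboolP; apply: arc_irr.
move=> r2 r1 r3 h12 h23; have [e|ne] := eqVneq r1 r3.
  by move/asboolP: h12; move/asboolP: h23; rewrite e => h23 /(arcN h23).
have [//|h31] := orP (tot _ _ ne).
pose T := [set val c; val r1; val r2; val r3]%SET.
have cT : val c \in T by rewrite !inE eqxx.
have T1 : val r1 \in T by rewrite !inE eqxx ?orbT.
have T2 : val r2 \in T by rewrite !inE eqxx ?orbT.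
have T3 : val r3 \in T by rewrite !inE eqxx ?orbT.
have [[r' c'] [/= r'T c'T]] := @face_sink_exists T (r1, c) T1 cT.
have -> : c' = c.
  apply: val_inj; move: c'T; rewrite !inE ![val c' == _]eq_sym !(negbTE (row_col _
    _)) !orbF.
  by move=> /eqP.
have : r' \in [:: r1; r2; r3].
  rewrite !inE; move: r'T; rewrite !inE (negbTE (row_col _ _)) /=.
  by rewrite !val_eqE -orbA.
rewrite !inE => /or3P[]/eqP->; by [move/(not_sinkV T1 T2 cT h12)|
  move/(not_sinkV T2 T3 cT h23)|move/(not_sinkV T3 T1 cT h31)].
Qed.

Section Square.
Context (r r' : rows) (c c' : cols).
Let T := [set val r; val r'; val c; val c']%SET.

Local Lemma squareT :
  [/\ val r \in T, val r' \in T, val c \in T & val c' \in T].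
Proof. by rewrite !inE !eqxx ?orbT. Qed.

Local Lemma square_corner (y : rows * cols) : val y.1 \in T -> val y.2 \in T ->
  (y.1 = r \/ y.1 = r') /\ (y.2 = c \/ y.2 = c').
Proof.
rewrite !inE !(negbTE (row_col _ _)) !orbF ![val y.2 == _]eq_sym.
rewrite ?(negbTE (row_col _ _)) /= => h1 h2; split.
  by case/orP: h1 => /eqP/val_inj; [left|right].
by case/orP: h2 => /eqP/val_inj; [left|right].
Qed.

Local Lemma square_no_cycle :
  ~~ [&& arcH r c c', arcV c' r r', arcH r' c' c & arcV c r' r].
Proof.
have [rT r'T cT c'T] := squareT.
apply/negP => /and4P[h1 h2 h3 h4].
have [[y1 y2] [/= y1T y2T]] := @face_sink_exists T (r, c) rT cT.
have [/= [->|->] [->|->]] := @square_corner (y1, y2) y1T y2T.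
- exact: not_sinkH h1.
- exact: not_sinkV h2.
- exact: not_sinkV h4.
- exact: not_sinkH h3.
Qed.

(** Opposite corners share neither row nor column, so no arc joins them, and both would be sinks of
    the face spanned by the square. *)
Local Lemma square_no_two_sinks :
  ~~ [&& arcH r c' c, arcV c r' r, arcH r' c c' & arcV c' r r'].
Proof.
have [rT r'T cT c'T] := squareT.
apply/negP => /and4P[h1 h2 h3 h4].
have rr := arcV_ne h4; have cc := arcH_ne h3.
have is_sink (x : rows) (y : cols) : val x \in T -> val y \in T ->
    (forall w : rows * cols, val w.1 \in T -> val w.2 \in T -> ~ arc (pos (x, y))
      (pos w)) ->
    face_sink T (pos (x, y)).
  move=> xT yT no; split.
    by apply/slack_face_vertex; split; [case: (posP (x, y))|rewrite pos_sub xT].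
  move=> w [aw [_ _ /slack_face_vertex[/vertex_pos[z ez] zT] _]].
  move: zT aw; rewrite ez pos_sub => /andP[z1 z2]; exact: no.
have cross : ~ arc (pos (r, c)) (pos (r', c')).
  by move=> /arc_share[]/= e; [move: rr|move: cc]; rewrite e eqxx.
have cross' : ~ arc (pos (r', c')) (pos (r, c)).
  by move=> /arc_share[]/= e; [move: rr|move: cc]; rewrite e eqxx.
have s1 : face_sink T (pos (r, c)).
  apply: is_sink => // -[w1 w2] /= w1T w2T.
  have [/= [->|->] [->|->]] := @square_corner (w1, w2) w1T w2T => //.
  - exact: arc_irr.
  - by apply: arcN; apply/asboolP.
  - by apply: arcN; apply/asboolP.
have s2 : face_sink T (pos (r', c')).
  apply: is_sink => // -[w1 w2] /= w1T w2T.
  have [/= [->|->] [->|->]] := @square_corner (w1, w2) w1T w2T => //.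
  - by apply: arcN; apply/asboolP.
  - by apply: arcN; apply/asboolP.
  - exact: arc_irr.
case: uso => _ /(_ _ (slack_face_face T)) [].
  by exists (pos (r, c)); split; [apply: vertex_in;
    case: (posP (r, c))|rewrite pos_sub rT].
move=> v [_ uniq]; have : pos (r, c) = pos (r', c') by rewrite -(uniq _ s1) -(uniq
  _ s2).
by move=> /pos_inj[e _]; move: rr; rewrite e eqxx.
Qed.
End Square.

Lemma polytope_grid_orientation : grid_orientation arcH arcV.
Proof.
split; [exact: arcH_total|exact: arcV_total| |] => r r' c c'.
  exact: square_no_two_sinks.
exact: square_no_cycle.
Qed.

Lemma card_grid : (maxn #|{: rows}| #|{: cols}| <= n)%N.
Proof.
by rewrite geq_max !card_sig -[X in (_ <= X)%N && _]card_ord -[X in _ && (_ <=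
  X)%N]card_ord !max_card.
Qed.

End Grid.
End Corank2.

(** * The random walk *)

Section Walk.
Local Open Scope classical_set_scope.
Context {R : realType} {V : choiceType} {vert : set V} {arc : V -> V -> Prop}.
Context {G : finType} {e : rel G} {pos : G -> V} {s0 : G}.
Hypothesis pos_inj : injective pos.
Hypothesis arcE : forall x y, arc (pos x) (pos y) <-> e x y.
Hypothesis arc_to : forall x v, arc (pos x) v -> exists y, v = pos y.
Hypothesis sinkE : forall v, sink vert arc v <-> v = pos s0.
Context {disp : measure_display} {Omega : measurableType disp}.
Context {Pr : probability Omega R} {x0 : G} {X : nat -> Omega -> V}.
Hypothesis walk : directed_random_walk vert arc Pr (pos x0) X.
Context {Psi : G -> R}.
Hypothesis Psi_ge0 : forall x, 0 <= Psi x.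
Hypothesis Psi_drift : forall x, x != s0 ->
  (0 < #|e x|)%N /\ 1 + (\sum_(y | e x y) Psi y) / #|e x|%:R <= Psi x.

Local Lemma out_degree x : #|` fset_set [set z | arc (pos x) z]| = #|e x|.
Proof.
have -> : [set z | arc (pos x) z] = [set` [fset z in [seq pos y | y <- enum (e
  x)]]%fset].
  apply/seteqP; split=> z /=.
    move=> /[dup] /arc_to[y ->] /arcE xy; rewrite inE; apply: map_f.
    by rewrite mem_enum.
  by rewrite inE => /mapP[y]; rewrite mem_enum => xy ->; apply/arcE.
rewrite set_fsetK card_fseq undup_id ?size_map -?cardE//.
by rewrite map_inj_uniq ?enum_uniq.
Qed.

Local Definition step (x y : G) : R := transition vert arc (pos x) (pos y).

Local Lemma step_sink y : step s0 y = (y == s0)%:R.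
Proof.
rewrite /step /transition; case: asboolP => [_|[]]; last exact/sinkE.
by rewrite (inj_eq pos_inj).
Qed.

Local Lemma step_other x y : x != s0 -> step x y = (e x y)%:R / #|e x|%:R.
Proof.
move=> xs; rewrite /step /transition; case: asboolP => [/sinkE/pos_inj/eqP|_].
  by rewrite (negbTE xs).
rewrite out_degree; case: asboolP => [/arcE ->|nxy]; first by rewrite mul1r.
by case: (boolP (e x y)) => [/arcE//|_]; rewrite mul0r.
Qed.

Local Lemma step_ge0 x y : 0 <= step x y.
Proof.
rewrite /step /transition; case: ifP => // _.
by case: ifP => // _; rewrite invr_ge0.
Qed.

Local Lemma sum_step x : \sum_y step x y = 1.
Proof.
have [->|xs] := eqVneq x s0.
  under eq_bigr do rewrite step_sink.
  by rewrite (bigD1 s0)//= eqxx big1 ?addr0// => y /negbTE ->.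
have [d0 _] := Psi_drift xs.
under eq_bigr do rewrite step_other//.
rewrite -mulr_suml -natr_sum; suff -> : (\sum_y e x y)%N = #|e x|.
  by rewrite divff// pnatr_eq0 -lt0n.
rewrite -sum1_card [RHS]big_mkcond; apply: eq_bigr => y _.
by rewrite unfold_in; case: (e x y).
Qed.

Local Lemma Psi_super x : (x != s0)%:R + \sum_y step x y * Psi y <= Psi x.
Proof.
have [->|xs] := eqVneq x s0.
  under eq_bigr do rewrite step_sink.
  rewrite add0r (bigD1 s0)//= eqxx mul1r big1 ?addr0//.
  by move=> y /negbTE ->; rewrite mul0r.
have [_] := Psi_drift xs; apply: le_trans;
  rewrite /= lerD2l mulr_suml [leRHS]big_mkcond /=.
apply: ler_sum => y _; rewrite step_other//.
by case: (e x y); rewrite /= ?mul0r// mul1r mulrC.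
Qed.

Local Definition at_ k v := [set t | X k t = v].
Local Definition history k (p : nat -> V) :=
  [set t | forall i, (i <= k)%N -> X i t = p i].

Local Lemma m_at k v : measurable (at_ k v).
Proof. by case: walk => mX _ _; apply: mX. Qed.

Local Lemma m_off k v : measurable (~` at_ k v).
Proof. exact/measurableC/m_at. Qed.

Local Lemma historyS k p : history k.+1 p = history k p `&` at_ k.+1 (p k.+1).
Proof.
apply/seteqP; split=> t /=.
  by move=> h; split=> [i ik|]; apply: h => //; apply: leqW.
move=> [h hk] i; rewrite leq_eqVlt => /orP[/eqP->//|]; exact: h.
Qed.

Local Lemma history0 p : history 0 p = at_ 0 (p 0%N).
Proof.
by apply/seteqP; split=> t /= => [h|h i]; [apply: h|rewrite leqn0 => /eqP->].
Qed.

Local Lemma m_history k p : measurable (history k p).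
Proof.
elim: k => [|k IH]; first by rewrite history0; apply: m_at.
by rewrite historyS; apply: measurableI => //; apply: m_at.
Qed.

Local Lemma m_avoid k (l : seq G) :
  measurable [set t | forall y, y \in l -> X k t <> pos y].
Proof.
elim: l => [|y l IH]; first by rewrite (_ : [set _ | _] = setT)//; apply/seteqP; split.
rewrite (_ : [set _ | _] = ~` at_ k (pos y) `&`
  [set t | forall y, y \in l -> X k t <> pos y]).
  by apply: measurableI => //; apply: m_off.
apply/seteqP; split=> t /=.
  move=> h; split=> [|z zl]; first by apply: h; rewrite mem_head.
  by apply: h; rewrite inE zl orbT.
by move=> [h1 h2] z; rewrite inE => /orP[/eqP->//|]; apply: h2.
Qed.

Local Lemma split_next k B (l : seq G) : measurable B -> uniq l ->
  Pr B = (\sum_(y <- l) Pr (B `&` at_ k (pos y)) +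
          Pr (B `&` [set t | forall y, y \in l -> X k t <> pos y]))%E.
Proof.
move=> mB; elim: l => [_|y l IH /= /andP[yl ul]].
  rewrite big_nil add0e; congr (Pr _); apply/seteqP.
  by split=> t /= => [Bt|[]//]; split.
rewrite big_cons {1}IH//.
set N := [set t | forall y, y \in l -> X k t <> pos y].
have mN : measurable N by apply: m_avoid.
rewrite (measureDI Pr (measurableI _ _ mB mN) (m_at k (pos y))).
have -> : B `&` N `&` at_ k (pos y) = B `&` at_ k (pos y).
  apply/seteqP; split=> t /=; first by move=> [[Bt _] ty].
  move=> [Bt ty]; split=> //; split=> // z zl.
  by rewrite ty => /pos_inj yz; rewrite yz zl in yl.
have -> : B `&` N `\` at_ k (pos y)
    = B `&` [set t | forall z, z \in y :: l -> X k t <> pos z].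
  apply/seteqP; split=> t /=.
    by move=> [[Bt Nt] nt]; split=> // z; rewrite inE => /orP[/eqP->//|]; apply: Nt.
  move=> [Bt h]; split; first by split=> // z zl; apply: h; rewrite inE zl orbT.
  by apply: h; rewrite mem_head.
by rewrite addeA addeC addeA.
Qed.

Local Definition extend k (p : nat -> V) (v : V) i := if i == k.+1 then v else p i.

Local Lemma extend_history k p v : history k (extend k p v) = history k p.
Proof.
apply/seteqP; split=> t /= h i ik; rewrite h// /extend.
  by case: eqP ik => // ->; rewrite ltnn.
by case: eqP ik => // ->; rewrite ltnn.
Qed.

Local Lemma Pr_extend k p x y : p k = pos x ->
  Pr (history k p `&` at_ k.+1 (pos y)) = (Pr (history k p) * (step x y)%:E)%E.
Proof.
move=> px; case: walk => _ _ /(_ k (extend k p (pos y))).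
rewrite -/(history k.+1 _) -/(history k _) historyS extend_history.
by rewrite /extend eqxx [k == _]ltn_eqF// px.
Qed.

(** Given the history, the transition probabilities to the cells of the grid already sum to 1. *)
Local Lemma off_grid k p x B : p k = pos x -> measurable B ->
  Pr (history k p `&` B `&` [set t | forall y, y \in enum G -> X k.+1 t <> pos y])
    = 0%E.
Proof.
move=> px mB; set N := [set t | _].
have mA := m_history k p.
have mN : measurable N by apply: m_avoid.
have Ne : Pr (history k p `&` N) = 0%E.
  have := split_next k.+1 mA (enum_uniq G).
  rewrite -/N; under eq_bigr do rewrite (Pr_extend _ px).
  rewrite big_enum /= -ge0_sume_distrr; last by move=> y _; rewrite lee_fin step_ge0.
  rewrite sumEFin sum_step mule1 => /(congr1 (fun z => z - Pr (history k p))%E).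
  have fin : Pr (history k p) \is a fin_num by apply: fin_num_measure.
  by rewrite addeAC subee// add0e => <-.
apply/eqP; rewrite eq_le measure_ge0 andbT -Ne; apply: le_measure.
- by rewrite inE; apply: measurableI => //; apply: measurableI.
- by rewrite inE; apply: measurableI.
- by move=> t [[]].
Qed.

(** The supermartingale estimate for [Psi], by induction on the horizon [N] for all histories at
    once: the event is split by the next cell, [Pr_extend] gives its probability, and [Psi_super]
    closes the step. Histories replace conditional expectations because the law of the walk is given
    on them. *)
Local Lemma visits_le N k p x : p k = pos x ->
  (\sum_(j < N) Pr (history k p `&` ~` at_ (k + j) (pos s0))
   <= Pr (history k p) * (Psi x)%:E)%E.
Proof.
elim: N k p x => [|N IH] k p x px.
  by rewrite big_ord0 mule_ge0// lee_fin.
have mA := m_history k p.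
rewrite big_ord_recl addn0.
have first_step : (Pr (history k p `&` ~` at_ k (pos s0))
    <= Pr (history k p) * ((x != s0)%:R)%:E)%E.
  have [xs|xs] := eqVneq x s0.
    rewrite mule0 (_ : _ `&` _ = set0) ?measure0//.
    by apply/seteqP; split=> t //= [h []]; rewrite /at_ /= h// px xs.
  rewrite mule1; apply: le_measure; rewrite ?inE//.
  by apply: measurableI => //; apply: m_off.
have next_step j : (Pr (history k p `&` ~` at_ (k + lift ord0 j) (pos s0))
    = \sum_(y <- enum G)
        Pr (history k.+1 (extend k p (pos y)) `&` ~` at_ (k.+1 + j) (pos s0)))%E.
  move=> /=.
  have -> : (k + lift ord0 j = k.+1 + j)%N by rewrite lift0 addnS.
  have mB := m_off (k.+1 + j) (pos s0).
  rewrite (split_next k.+1 (measurableI _ _ mA mB) (enum_uniq G)).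
  rewrite (off_grid px mB) adde0; apply: eq_bigr => y _; congr (Pr _).
  by rewrite historyS extend_history /extend eqxx setIAC.
under eq_bigr do rewrite next_step.
rewrite exchange_big /=.
apply: (@le_trans _ _ (Pr (history k p) * ((x != s0)%:R)%:E
   + \sum_(y <- enum G) Pr (history k p) * (step x y * Psi y)%:E)%E).
  apply: leeD => //; rewrite !big_enum /=; apply: lee_sum => y _.
  apply: (le_trans (IH k.+1 (extend k p (pos y)) y _)); first by rewrite /extend eqxx.
  rewrite historyS extend_history /extend eqxx (Pr_extend _ px) EFinM muleA.
  exact: lexx.
have nn y : (0 <= (step x y * Psi y)%:E)%E.
  by rewrite lee_fin mulr_ge0// step_ge0.
rewrite big_enum /= -ge0_sume_distrr// sumEFin -ge0_muleDr ?lee_fin//; last first.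
  by apply: sumr_ge0 => y _; have := nn y; rewrite lee_fin.
by apply: lee_wpmul2l => //; rewrite -EFinD lee_fin Psi_super.
Qed.

(** All times before the first arrival are spent off the sink; without an arrival the series exceeds
    every integer. *)
Local Lemma number_of_steps_le t : (number_of_steps vert arc X t
  <= \sum_(0 <= k <oo) (\1_(~` at_ k (pos s0)) t)%:E :> \bar R)%E.
Proof.
have nn k : (0%N <= k)%N -> true -> (0 <= (\1_(~` at_ k (pos s0)) t)%:E :> \bar R)%E.
  by move=> _ _; rewrite lee_fin.
have partial N : (forall k, (k < N)%N -> X k t <> pos s0) ->
    (N%:R%:E <= \sum_(0 <= k <oo) (\1_(~` at_ k (pos s0)) t)%:E :> \bar R)%E.
  move=> before; apply: le_trans (nneseries_lim_ge N nn).
  rewrite big_nat (eq_bigr (fun=> 1%E)); last first.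
    move=> k /andP[_ kN]; by rewrite indicE mem_set//; apply: before.
  by rewrite -big_nat sumEFin sumr_const_nat subn0.
have [[k hit]|never] := pselect (exists k, X k t = pos s0).
  have ex : exists k, `[< X k t = pos s0 >] by exists k; apply/asboolP.
  case: (ex_minnP ex) => N /asboolP hN min.
  apply: (@le_trans _ _ (N%:R%:E)); last first.
    apply: partial => j jN hj; have := min j; rewrite leqNgt jN => /(_ _)/negP;
      apply => //.
    exact/asboolP.
  by apply: ereal_inf_lbound; exists N => //=; apply/sinkE.
suff -> : (\sum_(0 <= k <oo) (\1_(~` at_ k (pos s0)) t)%:E = +oo :> \bar R)%E by
  rewrite leey.
have big N : (N%:R%:E <= \sum_(0 <= k <oo) (\1_(~` at_ k (pos s0)) t)%:E :> \bar R)%E.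
  by apply: partial => k _ hk; apply: never; exists k.
move: big; case: (lim _) => [r| |] big //.
  have := big (Num.truncn `|r|).+1; rewrite lee_fin leNgt => /negP[].
  by apply: le_lt_trans (ler_norm r) _; rewrite truncnS_gt.
by have := big 0%N; rewrite leeNy_eq.
Qed.

Lemma expected_number_of_steps :
  (\int[Pr]_t number_of_steps vert arc X t <= (Psi x0)%:E)%E.
Proof.
have nn k t : (0 <= (\1_(~` at_ k (pos s0)) t)%:E :> \bar R)%E by rewrite lee_fin.
apply: (@le_trans _ _
  (\int[Pr]_t (\sum_(0 <= k <oo) (\1_(~` at_ k (pos s0)) t)%:E))%E).
  (* As suprema over simple functions, the integrals compare without measurability of
     [number_of_steps]. *)
  rewrite !ge0_integralTE//.
  - apply: ereal_sup_le => _ [h hf <-]; exists h => // t.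
    exact: le_trans (hf t) (number_of_steps_le t).
  - by move=> t; apply: nneseries_ge0.
  - by move=> t; apply: le_ereal_inf_tmp => _ [k _ <-]; rewrite lee_fin.
rewrite integral_nneseries//; last first.
  move=> k; apply/measurable_realfun.measurable_EFinP;
    apply: measurable_realfun.measurable_indic; exact: m_off.
have ind k : (\int[Pr]_t (\1_(~` at_ k (pos s0)) t)%:E = Pr (~` at_ k (pos s0)))%E.
  by rewrite integral_indic ?setIT//; apply: m_off.
under eq_eseriesr do rewrite ind.
apply: lime_le; first by apply: is_cvg_nneseries.
apply: nearW => N.
have A0 : Pr (history 0 (fun=> pos x0)) = 1%E.
  by case: walk => _ + _; rewrite history0.
apply: le_trans (_ : Pr (history 0 (fun=> pos x0)) * (Psi x0)%:E <= _)%E; last first.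
  by rewrite A0 mul1e.
apply: le_trans (visits_le N (erefl _)).
rewrite big_mkord; apply: lee_sum => j _; rewrite add0n.
have mA := m_history 0 (fun=> pos x0); have mB := m_off j (pos s0).
(* The part outside the initial history is null, since the start is almost surely [pos x0]. *)
rewrite (measureDI Pr mB mA) [X in (X + _)%E](_ : _ = 0%E) ?add0e 1?setIC//.
apply/eqP; rewrite eq_le measure_ge0 andbT.
apply: (@le_trans _ _ (Pr (~` history 0 (fun=> pos x0)))).
  by apply: le_measure; rewrite ?inE;
    [apply: measurableD|apply: measurableC|move=> t []].
by rewrite probability_setC// A0 subee.
Qed.
End Walk.

(** * Logarithmic bounds and the conclusion *)

Lemma run_le_ln (R : realType) (k t : nat) : (0 < k)%N -> (0 < t)%N ->
  run k t <= 1 + ln t%:R :> R.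
Proof.
move=> k0 t0; rewrite /run; case: ltnP => [_|kt].
  by rewrite addr_ge0// ln_ge0// ler1n.
rewrite lerD2l; elim: t kt t0 => [|t IH]; first by rewrite leqNgt k0.
rewrite leq_eqVlt => /orP[/eqP<- _|]; first by rewrite big_geq// ln_ge0// ler1n.
rewrite ltnS => kt _; have t0 : (0 < t)%N by apply: leq_trans kt.
rewrite big_nat_recr//=; apply: le_trans (lerD (IH kt t0) (lexx _)) _.
have p1 : 0 < t.+1%:R :> R by rewrite ltr0n.
have p0 : 0 < t%:R :> R by rewrite ltr0n.
rewrite addrC -lerBrDr -[leLHS]opprK lerNl opprB -ln_div ?posrE//.
have -> : t%:R / t.+1%:R = 1 + - t.+1%:R^-1 :> R.
  by rewrite -natr1; field; rewrite natr1 gt_eqF.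
(* The inequality [ln (1 + x) <= x] at minus the new term bounds that term by
   [ln t.+1%:R - ln t%:R]. *)
apply: le_ln1Dx; rewrite ltrN2 invf_lt1// ltr1n.
by rewrite ltnS.
Qed.

Lemma ln2_ge_half (R : realType) : 2^-1 <= ln 2 :> R.
Proof.
have : ln (1 + - 2^-1) <= - 2^-1 :> R by apply: le_ln1Dx; lra.
have -> : 1 + - 2^-1 = 2^-1 :> R by lra.
by rewrite lnV ?posrE// lerN2.
Qed.

Lemma trunc_log_le_ln (R : realType) (n : nat) : (1 < n)%N ->
  (trunc_log 2 n).+1%:R <= 4 * ln n%:R :> R.
Proof.
move=> n1; have n0 : (0 < n)%N by apply: ltnW.
have h2 := ln2_ge_half R.
have ln2n : ln 2 <= ln n%:R :> R by rewrite ler_ln ?posrE ?ltr0n// ler_nat.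
have : (trunc_log 2 n)%:R * ln 2 <= ln n%:R :> R.
  rewrite mulr_natl -lnXn// ler_ln ?posrE ?exprn_gt0 ?ltr0n// -natrX ler_nat.
  exact: trunc_logP.
have : (trunc_log 2 n)%:R * 2^-1 <= (trunc_log 2 n)%:R * ln 2 :> R.
  by apply: ler_wpM2l.
rewrite -(natr1 (trunc_log 2 n)); lra.
Qed.

Local Open Scope classical_set_scope.
Local Open Scope card_scope.
Local Open Scope ring_scope.

Theorem theorem1 (R : realType) :
  exists C : R, 0 < C /\
  forall (m n d : nat) (P : set 'rV[R]_m)
    (arc : 'rV[R]_m -> 'rV[R]_m -> Prop) (v0 : 'rV[R]_m)
    (disp : measure_display) (Omega : measurableType disp)
    (Pr : probability Omega R) (X : nat -> Omega -> 'rV[R]_m),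
  simple_polytope P d ->
  [set F | facet P F] #= `I_n ->
  (n - d)%N = 2%N ->
  unique_sink_orientation P arc ->
  vertex P v0 ->
  directed_random_walk (vertex P) arc Pr v0 X ->
  (\int[Pr]_t number_of_steps (vertex P) arc X t <= (C * ln n%:R ^+ 2)%:E)%E.
Proof.
(* 3000 is [4 * 125 * 6]: there are at most [4 * ln n%:R] phases of cost [125 * eta], and
   [eta = 2 * (1 + ln n%:R)] is at most [6 * ln n%:R] because [1 <= 2 * ln n%:R]. *)
exists 3000; split=> [|m n d P arc v0 disp Omega Pr X Psimple facets nd uso vv0 walk].
  by rewrite ltr0n.
have P0 : P !=set0 by exists v0; apply: vertex_in.
have [x0 [L [a [b [PE dimL tight]]]]] := simple_polytope_system Psimple P0 facets.
have Pe x : P x <-> x - x0 \in L /\ forall i, inner (a i) x <= b i by rewrite PE.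
have Pb : bounded_set P by case: Psimple => -[].
have nd2 : n = d.+2 by lia.
have [A AP] := slack_bipartite Pe Pb dimL nd2 tight vv0.
pose p := pos (P := P) (a := a) (b := b) (A := A).
have oHV := polytope_grid_orientation Pe dimL nd2 tight AP uso.
set H := arcH in oHV; set V := arcV in oHV.
have vertexE v : vertex P v <-> exists x, v = p x := vertex_pos Pe nd2 tight AP v.
have arcE x y : arc (p x) (p y) <-> grid_arc H V x y :=
  arc_pos Pe dimL nd2 tight AP uso x y.
have arc_to x v : arc (p x) v -> exists y, v = p y.
  by move=> h; apply/vertexE; case: uso => -[/(_ _ _ h)[]].
have faceP : face P P.
  exists 0, 0; split=> [x _|]; first by rewrite inner0l.
  by apply/seteqP; split=> [x Px|x []//]; split=> //=; rewrite inner0l.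
have [s [[vs sinks] suniq]] := uso.2 P faceP P0.
have [s0 es] := (vertexE s).1 vs.
have sinkE v : sink (vertex P) arc v <-> v = p s0.
  split=> [[vv nv]|->]; first by rewrite -es; apply/esym/suniq; split=> // w [/nv].
  rewrite -es; split=> // w sw; apply: (sinks w); split=> //.
  by case: uso => -[/(_ _ _ sw)].
have s0_sink y : ~~ grid_arc H V s0 y.
  by apply/negP => /arcE; have [_] := (sinkE (p s0)).2 erefl; apply.
have [y0 ey0] := (vertexE v0).1 vv0.
have n1 : (1 < n)%N by rewrite nd2.
have ln0 : 1 <= 2 * ln n%:R :> R.
  have := ln2_ge_half R; have : ln 2 <= ln n%:R :> R by rewrite ler_ln ?posrE
    ?ltr0n ?ler_nat//; lia.
  lra.
pose eta : R := 2 * (1 + ln n%:R).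
have eta1 : 1 <= eta by rewrite /eta; lra.
have card_le := card_grid (n := n) (A := A).
have run_eta k t : (0 < k)%N ->
    (t <= maxn #|{: {i : 'I_n | i \in A}}| #|{: {i : 'I_n | i \notin A}}|)%N ->
    2 * run k t <= eta.
  move=> k0 tn; rewrite /eta ler_pM2l//; case: t tn => [|t] tn.
    by rewrite run_small//; lra.
  apply: le_trans (@run_le_ln R k t.+1 k0 isT) _; rewrite lerD2l ler_ln ?posrE ?ltr0n//.
    by rewrite ler_nat; apply: leq_trans tn card_le.
  exact: ltnW.
have [Psi [bnd drift]] := walk_time oHV s0_sink eta1 run_eta
  (leq_ltn_trans card_le (trunc_log_ltn n (isT : (1 < 2)%N))).
rewrite ey0 in walk.
have Psi0 x : 0 <= Psi x by case/andP: (bnd x).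
have Psi_drift x : x != s0 -> (0 < #|grid_arc H V x|)%N /\
    1 + (\sum_(y | grid_arc H V x y) Psi y) / #|grid_arc H V x|%:R <= Psi x.
  by move=> /drift; rewrite cardsE.
apply: (le_trans (expected_number_of_steps (pos_inj AP) arcE arc_to sinkE walk Psi0
  Psi_drift)).
rewrite lee_fin; case/andP: (bnd y0) => _ /le_trans; apply.
have := @trunc_log_le_ln R n n1; set l := (trunc_log 2 n).+1%:R => hl.
have : l * (125 * eta) <= 4 * ln n%:R * (125 * eta) by apply: ler_wpM2r => //; lra.
rewrite /eta expr2; nra.
Qed.
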